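(* The optimal values of the following two minimization problems are equal: (i) the saddle point relaxation $$\min_{\phi\in C''}\ \sup_{(\psi,\psi')\in D}\ \Big\{G_0(\phi)+\nu\Big(\int_0^1\psi\,d\mu^\phi-\int_0^1\psi'\,d\mu^0\Big)\Big\};$$ (ii) the relaxation with Hoeffding–Fréchet bounds $$\min_{\phi,F}\ G_0(\phi)+\nu\int_{\mathbb{R}^2}c\,dF$$ over all $\phi\in C''$ and all distribution functions $F$ on $\mathbb{R}^2$ satisfying, for all $(\gamma_1,\gamma_2)\in\mathbb{R}^2$, $$F_\phi(\gamma_1)+F_{\mu^0}(\gamma_2)-1\ \le\ F(\gamma_1,\gamma_2)\ \le\ \min\{F_\phi(\gamma_1),F_{\mu^0}(\gamma_2)\}.$$ Here $G_0(\phi)=-\int_{\Omega\times[0,1]}f(\gamma,x)\,dD_\gamma\phi(x,\gamma)+\lambda\int_0^1\mathrm{TV}(\phi(\cdot,\gamma))\,d\gamma$, $F_\phi(\gamma)=\frac{1}{|\Omega|}\,(-D_\gamma\phi)(\Omega\times[0,\gamma])$ and $F_{\mu^0}(\gamma)=\mu^0([0,\gamma])$.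
   Context: $\Omega\subset\mathbb{R}^2$ is an image domain (e.g. $[0,1]^2$) with Lebesgue measure $0<|\Omega|<\infty$; distributional derivatives and total variations are taken in the interior of $\Omega$ (respectively of $\Omega\times\mathbb{R}$). $\lambda>0$, $\nu>0$ are parameters, $\mu^0$ is a given Borel probability measure on $[0,1]$, and $f:[0,1]\times\Omega\to\mathbb{R}$ is continuous. The cost $c:[0,1]\times[0,1]\to\mathbb{R}$ is lower semicontinuous and there exist upper semicontinuous $a,b\in L^1([0,1])$ with $c(\gamma_1,\gamma_2)\ge a(\gamma_1)+b(\gamma_2)$ for all $\gamma_1,\gamma_2\in[0,1]$. The total variation is $\mathrm{TV}(v)=\sup\{\int_\Omega v\,\mathrm{div}\,\xi\,dx : \xi\in C_c^1(\Omega,\mathbb{R}^2),\ \|\xi\|_\infty\le 1\}$. Points of $\Omega\times\mathbb{R}$ are written $(x,\gamma)$ and $D_\gamma\phi$ denotes the distributional partial derivative of $\phi$ in the $\gamma$-direction. Define $$C''=\{\phi\in BV(\Omega\times\mathbb{R},[0,1]) : \phi(\cdot,\gamma)\equiv 1\ \text{for}\ \gamma\le 0,\ \ \phi(\cdot,\gamma)\equiv 0\ \text{for}\ \gamma\ge 1,\ \ D_\gamma\phi\le 0\};$$ since such $\phi$ equal $1$ for $\gamma\le 0$, membership in $BV$ is understood on $\Omega\times I$ for bounded open intervals $I\supset[0,1]$. For $\phi\in C''$ the measure $D_\gamma\phi$ is concentrated on $\Omega\times[0,1]$, and $\mu^\phi$ is the probability measure on $[0,1]$ with $\mu^\phi(A)=\frac{1}{|\Omega|}\,(-D_\gamma\phi)(\Omega\times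 A)$. Define $$D=\{(\psi,\psi') : \psi,\psi':[0,1]\to\mathbb{R},\ \psi,\psi'\in L^1([0,1]),\ \psi(\gamma_1)-\psi'(\gamma_2)\le c(\gamma_1,\gamma_2)\ \ \forall\gamma_1,\gamma_2\in[0,1]\}.$$ In the supremum over $D$, only those pairs are considered for which $\int\psi\,d\mu^\phi$ and $\int\psi'\,d\mu^0$ are defined and finite. A distribution function $F$ on $\mathbb{R}^2$ is the cumulative distribution function of a Borel probability measure $dF$ on $\mathbb{R}^2$, i.e. $F(\gamma_1,\gamma_2)=dF((-\infty,\gamma_1]\times(-\infty,\gamma_2])$. For $\gamma<0$, $[0,\gamma]=\emptyset$, so $F_\phi(\gamma)=F_{\mu^0}(\gamma)=0$. Under the constraints in (ii) the measure $dF$ is concentrated on $[0,1]^2$, so $\int_{\mathbb{R}^2}c\,dF$ means $\int_{[0,1]^2}c\,dF$. *)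

(* Defs.v *)
(* The real line is an arbitrary [R : realType]; points of the plane are pairs
   in [R * R] and points of Omega x R are pairs (x, gamma) in [R * R * R]. *)
From HB Require Import structures.
From mathcomp Require Import all_boot all_order all_algebra.
From mathcomp Require Import all_classical all_reals all_analysis.

Set Implicit Arguments.
Unset Strict Implicit.
Unset Printing Implicit Defensive.

Import Order.TTheory GRing.Theory Num.Theory.
Import numFieldNormedType.Exports.

Local Open Scope classical_set_scope.
Local Open Scope ring_scope.

(* [R * R] and [R * R * R] with their Borel sigma-algebras; [lebesgue_measure]
   lives on [measurableTypeR R], which is convertible to [R]. *)
Notation mline R := (measurableTypeR R).
Notation mplane R := (measurableTypeR R * measurableTypeR R)%type.
Notation mspace R := (measurableTypeR R * measurableTypeR R * measurableTypeR R)%type.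

Notation leb1 R := (@lebesgue_measure R).
Notation leb2 R := (@lebesgue_measure R \x @lebesgue_measure R)%E.
Notation leb3 R := ((@lebesgue_measure R \x @lebesgue_measure R) \x @lebesgue_measure R)%E.

(* [dom_bd]: distributional derivatives are taken in the interior of Omega, so
   for phi in [Cpp] below the measure [mu_phi] has total mass
   |interior Omega| / |Omega|; it is a probability only if the part of the
   boundary lying in Omega is negligible. *)
Record image_domain (R : realType) := ImageDomain {
  dom :> set (R * R) ;
  dom_meas : measurable (dom : set (mplane R)) ;
  dom_gt0 : (0 < leb2 R dom)%E ;
  dom_lty : (leb2 R dom < +oo)%E ;
  dom_bd : leb2 R (dom `\` dom°) = 0%E
}.

Section definitions.
Context {R : realType}.

Implicit Type Om : image_domain R.

(* C^1 functions with compact support in the open set U, extended by 0 to V. *)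
Definition C1c (V : normedModType R) (U : set V) (xi : V -> R) : Prop :=
  [/\ forall x, differentiable xi x,
      forall v, continuous ('D_v xi),
      compact (closure [set x | xi x != 0]) &
      closure [set x | xi x != 0] `<=` U].

(* Test fields are bounded by 1 in the Euclidean norm (isotropic variation). *)
Definition TV Om (v : R * R -> R) : \bar R :=
  ereal_sup [set t | exists xi1 xi2 : R * R -> R,
    [/\ C1c Om° xi1, C1c Om° xi2,
        forall x, xi1 x ^+ 2 + xi2 x ^+ 2 <= 1 &
        t = (\int[leb2 R]_(x in Om)
              (v x * ('D_(1, 0) xi1 x + 'D_(0, 1) xi2 x))%:E)%E]].

Definition TV_cylinder Om (I : set R) (u : R * R * R -> R) : \bar R :=
  ereal_sup [set t | exists xi1 xi2 xi3 : R * R * R -> R,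
    [/\ [/\ C1c (Om° `*` I) xi1, C1c (Om° `*` I) xi2 & C1c (Om° `*` I) xi3],
        forall p, xi1 p ^+ 2 + xi2 p ^+ 2 + xi3 p ^+ 2 <= 1 &
        t = (\int[leb3 R]_(p in Om `*` I)
              (u p * ('D_(1, 0, 0) xi1 p + 'D_(0, 1, 0) xi2 p
                      + 'D_(0, 0, 1) xi3 p))%:E)%E]].

Definition BV_cylinder Om (I : set R) (u : R * R * R -> R) : Prop :=
  (leb3 R).-integrable (Om `*` I) (EFin \o u) /\
  (TV_cylinder Om I u < +oo)%E.

(* The nonnegative measure m is - D_gamma phi: it is carried by the open set
   (interior Omega) x R and represents the distributional derivative there. *)
Definition is_opp_Dgamma Om (phi : R * R -> R -> R)
    (m : {finite_measure set (mspace R) -> \bar R}) : Prop :=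
  m (~` (Om° `*` [set: R])) = 0%E /\
  forall xi : R * R * R -> R, C1c (Om° `*` [set: R]) xi ->
    (\int[leb3 R]_(p in Om `*` [set: R]) (phi p.1 p.2 * 'D_(0, 0, 1) xi p)%:E
     = \int[m]_p (xi p)%:E)%E.

(* Elements of BV are represented by functions defined everywhere; the
   pointwise constraints select a representative of the a.e. class. *)
Definition Cpp Om (phi : R * R -> R -> R) : Prop :=
  [/\ forall a b, a < 0 -> 1 < b ->
        BV_cylinder Om `]a, b[ (fun p => phi p.1 p.2),
      forall x g, dom Om x -> 0 <= phi x g <= 1,
      forall x g, dom Om x -> g <= 0 -> phi x g = 1,
      forall x g, dom Om x -> 1 <= g -> phi x g = 0 &
      exists m, is_opp_Dgamma Om phi m].

(* - D_gamma phi.  The representing measure is unique on measurable sets; the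
   zero measure is returned when D_gamma phi is not a nonpositive measure. *)
Definition opp_Dgamma Om (phi : R * R -> R -> R) :
    {finite_measure set (mspace R) -> \bar R} :=
  if pselect (exists m, is_opp_Dgamma Om phi m) is left ex
  then projT1 (cid ex) else mzero.

Definition mu_phi Om (phi : R * R -> R -> R) (A : set (mline R)) : \bar R :=
  ((fine (leb2 R Om))^-1%:E * opp_Dgamma Om phi (Om `*` (A `&` `[0%R, 1%R])))%E.

Section mu_phi_measure.
Variables (Om : image_domain R) (phi : R * R -> R -> R).
Local Notation mu := (mu_phi Om phi).

Let mu_phi0 : mu set0 = 0%E.
Proof. by rewrite /mu_phi set0I setX0 measure0 mule0. Qed.

Let mu_phi_ge0 A : (0 <= mu A)%E.
Proof. by rewrite /mu_phi mule_ge0// lee_fin invr_ge0 fine_ge0. Qed.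

Let mu_phi_sigma_additive : semi_sigma_additive mu.
Proof.
move=> F mF tF mUF; rewrite /mu_phi.
rewrite [X in X @ \oo --> _](_ : _ = (fun n => (fine (leb2 R Om))^-1%:E *
    \sum_(0 <= i < n) opp_Dgamma Om phi (Om `*` (F i `&` `[0%R, 1%R])))%E); last first.
  by apply/funext => k; rewrite ge0_sume_distrr.
apply: cvgeZl => //; rewrite setI_bigcupl.
rewrite (_ : dom Om `*` _ = \bigcup_i (Om `*` (F i `&` `[0%R, 1%R]))); last first.
  by apply/seteqP; split=> [[x g] [/= Ox [i _ Fg]]|[x g] [i _ [/= Ox Fg]]];
    [exists i | split=> //; exists i].
have mOF i : measurable (Om `*` (F i `&` `[0%R, 1%R]) : set (mspace R)).
  apply: measurableX; first exact: dom_meas.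
  by apply: measurableI => //; exact: measurable_itv.
apply: measure_semi_sigma_additive => //; last exact: bigcup_measurable.
apply/trivIsetP => i j _ _ ij; move/trivIsetP : tF => /(_ i j Logic.I Logic.I ij).
rewrite -subset0 => FF; rewrite -subset0 => -[x g] [[_ [Fi _]] [_ [Fj _]]].
exact: (FF g).
Qed.

HB.instance Definition _ := isMeasure.Build _ _ _ mu
  mu_phi0 mu_phi_ge0 mu_phi_sigma_additive.

End mu_phi_measure.

Definition F_phi Om (phi : R * R -> R -> R) (g : R) : \bar R :=
  ((fine (leb2 R Om))^-1%:E * opp_Dgamma Om phi (Om `*` `[0%R, g]))%E.

Definition F_mu0 (mu0 : probability (mline R) R) (g : R) : \bar R :=
  mu0 `[0%R, g]%classic.

(* [opp_Dgamma] is - D_gamma phi, hence the plus sign.  Continuity of f on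
   [0, 1] x Omega does not bound f when Omega is not compact; the library
   integral is (+oo) - (+oo) = -oo when both parts of f are infinite. *)
Definition G0 Om (lam : R) (f : R -> R * R -> R) (phi : R * R -> R -> R) :
    \bar R :=
  (\int[opp_Dgamma Om phi]_(p in Om `*` `[0%R, 1%R]) (f p.2 p.1)%:E
   + lam%:E * \int[leb1 R]_(g in `[0%R, 1%R]) TV Om (phi ^~ g))%E.

Definition L1_01 (psi : R -> R) : Prop :=
  (leb1 R).-integrable `[0, 1] (EFin \o psi).

Definition dual_pair (c : R -> R -> R) (psi psi' : R -> R) : Prop :=
  [/\ L1_01 psi, L1_01 psi' &
      forall g1 g2, 0 <= g1 <= 1 -> 0 <= g2 <= 1 -> psi g1 - psi' g2 <= c g1 g2].

(* F is the distribution function of the probability P on the plane. *)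
Definition is_cdf2 (P : probability (mplane R) R) (F : R -> R -> R) : Prop :=
  forall g1 g2, (F g1 g2)%:E = P (`]-oo, g1] `*` `]-oo, g2]).

Definition upper_semicontinuous (X : topologicalType) (h : X -> \bar R) : Prop :=
  forall x r, (h x < r%:E)%E ->
    exists2 V, nbhs x V & forall y, V y -> (h y < r%:E)%E.

End definitions.

(* Main.v *)
From HB Require Import structures.
Require Import Defs.
From mathcomp Require Import all_boot all_order all_algebra.
From mathcomp Require Import all_classical all_reals all_analysis.
From mathcomp Require Import measurable_realfun.
From mathcomp Require Import ring lra.
Import Order.TTheory GRing.Theory Num.Theory.
Import numFieldNormedType.Exports.
Local Open Scope classical_set_scope.
Local Open Scope ring_scope.

(** For a fixed [phi] both problems contain the same term [G0 phi], and the rest is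
    the optimal transport problem between [mu_phi] and [mu0] for the cost [c]: the
    first problem maximizes the Kantorovich dual, the second minimizes the cost
    over the laws [dF] allowed by the Hoeffding-Frechet bounds.  Two facts make
    these equal for each [phi], and then the infima over [phi] are equal.

    The bounds say exactly that [dF] is a coupling.  Couplings satisfy them by
    inclusion-exclusion ([frechet_of_marginals]).  Conversely, [mu0] has mass 1
    on [0, 1], so at [g2 = 1] the lower and upper bounds coincide and give the
    first marginal of [dF], and symmetrically for the second; integrating the
    dual inequality is then legitimate ([weak_duality]).  All this uses that
    [mu_phi] is a probability, which is not part of the definition: it follows
    by testing the distributional derivative of [phi] against products of a
    cutoff of the interior of [Omega] and a plateau on [0, T]
    ([opp_Dgamma_slab]).

    There is no duality gap ([coupling_exists]).  Let [D] be an upper bound of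
    the dual values.  By the Hahn-Banach theorem ([dominated_linear]) there is a
    positive linear functional [L] on the bounded functions on the square which
    has the marginals [mu_phi] and [mu0] and satisfies [L h <= D] for each bounded
    [h <= c] ([dual_functional]).  It is only finitely additive.  Its values on
    dyadic cells define nested subintervals of [0, 1), hence a random sequence
    of shrinking closed cells ([random_word]) and a random limit point.  The law
    of this point is a countably additive coupling: rounding the coordinates
    down to dyadic numbers costs nothing in the limit, because distribution
    functions are right continuous, and the infima of [c] on the cells converge
    to the value of [c] at the point, because [c] is lower semicontinuous, so
    that the Fatou lemma bounds the cost by [D].

    It remains to treat infinite values.  When [G0 phi] is minus infinity, so are
    both values at [phi], since some coupling exists; when it is plus infinity, so
    is the dual supremum, since a constant minorant of [c] gives a dual pair; and
    when the supremum is plus infinity, every coupling will do. *)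

(** * Hahn-Banach for sublinear functionals *)

(** The inequality for positive scalars is enough: applied to the inverse scalar
    it gives equality. *)
Definition sublinear_on (R : realType) (V : lmodType R) (S : set V) (q : V -> R) :=
  (forall x y, S x -> S y -> q (x + y) <= q x + q y) /\
  (forall a x, 0 < a -> S x -> q (a *: x) <= a * q x).

Section sublinear.
Context (R : realType) (V : lmodType R) (S : set V).
Hypothesis SD : forall x y, S x -> S y -> S (x + y).
Hypothesis SZ : forall a x, S x -> S (a *: x).

Let SN x : S x -> S (- x). Proof. by rewrite -scaleN1r; exact: SZ. Qed.

Lemma sublinear_on0 q x : sublinear_on R V S q -> S x -> q 0 = 0.
Proof.
move=> [_ qZ] Sx; have S0 : S 0 by rewrite -(scale0r x); exact: SZ.
have h a : 0 < a -> q 0 <= a * q 0 by move=> a0; rewrite -{1}(scaler0 _ a); exact: qZ.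
have := h 2 (ltr0n _ 2); have := h 2^-1 (ltac:(by rewrite invr_gt0)); lra.
Qed.

Lemma sublinear_on_opp q x : sublinear_on R V S q -> S x -> - q (- x) <= q x.
Proof.
move=> qs Sx; have := qs.1 _ _ Sx (SN _ Sx).
by rewrite subrr (sublinear_on0 q x)//; lra.
Qed.

(** Chains have lower bounds: to compare the infimum at [x + y] with
    [q1 x + q2 y], use the smaller of [q1] and [q2] at both points. *)
Lemma sublinear_on_inf (A : set (V -> R)) (q0 : V -> R) : A q0 ->
  (forall q, A q -> sublinear_on R V S q) ->
  (forall x, S x -> has_lbound [set q x | q in A]) ->
  (forall q1 q2, A q1 -> A q2 ->
    (forall x, S x -> q1 x <= q2 x) \/ (forall x, S x -> q2 x <= q1 x)) ->
  sublinear_on R V S (fun x => inf [set q x | q in A]).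
Proof.
move=> Aq0 Asub Alb Atot; split.
- move=> x y Sx Sy.
  have ne z : [set q z | q in A] !=set0 by exists (q0 z), q0.
  rewrite /= -lerBlDr; apply: lb_le_inf => // _ [q1 Aq1 <-].
  rewrite lerBlDr -lerBlDl; apply: lb_le_inf => // _ [q2 Aq2 <-].
  rewrite lerBlDl.
  have [q12|q21] := Atot _ _ Aq1 Aq2.
  - apply: (@le_trans _ _ (q1 (x + y))).
      by apply: ge_inf; [exact/Alb/SD|exists q1].
    apply: le_trans ((Asub _ Aq1).1 _ _ Sx Sy) _.
    by have := q12 y Sy; lra.
  - apply: (@le_trans _ _ (q2 (x + y))).
      by apply: ge_inf; [exact/Alb/SD|exists q2].
    apply: le_trans ((Asub _ Aq2).1 _ _ Sx Sy) _.
    by have := q21 x Sx; lra.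
- move=> a x a0 Sx; rewrite /= -ler_pdivrMl//; apply: lb_le_inf.
    by exists (q0 x), q0.
  move=> _ [q Aq <-]; rewrite ler_pdivrMl//.
  apply: le_trans ((Asub _ Aq).2 _ _ a0 Sx).
  by apply: ge_inf; [exact/Alb/SZ|exists q].
Qed.

(** Lowering [q] along the ray through [y] keeps it sublinear; taking [t = 1]
    forces [q x + q y <= q (x + y)] as soon as [q] is minimal. *)
Lemma sublinear_on_dir q y : sublinear_on R V S q -> S y ->
  let q' x := inf [set q (x + t *: y) - t * q y | t in [set t | 0 <= t]] in
  [/\ sublinear_on R V S q', forall x, S x -> q' x <= q x &
      forall x, S x -> q' x <= q (x + y) - q y].
Proof.
move=> qs Sy q'.
have lb x : S x -> has_lbound [set q (x + t *: y) - t * q y | t in [set t | 0 <= t]].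
  move=> Sx; exists (- q (- x)) => _ [t /= t0 <-].
  have := qs.1 _ _ (SD _ _ Sx (SZ t _ Sy)) (SN _ Sx); rewrite addrAC subrr add0r.
  have [->|tn0] := eqVneq t 0.
    by rewrite scale0r mul0r !addr0 (sublinear_on0 q x)//; lra.
  have {}t0 : 0 < t by rewrite lt_def tn0.
  have := qs.2 t^-1 (t *: y); rewrite scalerA mulVf ?gt_eqF// scale1r invr_gt0.
  by move=> /(_ t0 (SZ _ _ Sy)); rewrite ler_pdivlMl//; lra.
have ne x : [set q (x + t *: y) - t * q y | t in [set t | 0 <= t]] !=set0.
  by exists (q (x + 0 *: y) - 0 * q y), 0 => /=.
have le x t : S x -> 0 <= t -> q' x <= q (x + t *: y) - t * q y.
  by move=> Sx t0; apply: ge_inf; [exact: lb|exists t].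
split; last 2 first.
- by move=> x Sx; have := le x 0 Sx (lexx _); rewrite scale0r mul0r addr0 subr0.
- by move=> x Sx; have := le x 1 Sx ler01; rewrite scale1r mul1r.
split.
- move=> x1 x2 S1 S2.
  rewrite -lerBlDr; apply: lb_le_inf => // _ [t1 /= t10 <-].
  rewrite lerBlDr -lerBlDl; apply: lb_le_inf => // _ [t2 /= t20 <-].
  rewrite lerBlDl.
  apply: le_trans (le (x1 + x2) (t1 + t2) (SD _ _ S1 S2) (addr_ge0 t10 t20)) _.
  have := qs.1 _ _ (SD _ _ S1 (SZ t1 _ Sy)) (SD _ _ S2 (SZ t2 _ Sy)).
  by rewrite scalerDl addrACA mulrDl; lra.
- move=> a x a0 Sx; rewrite -ler_pdivrMl//; apply: lb_le_inf => // _ [t /= t0 <-].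
  rewrite ler_pdivrMl//.
  apply: le_trans (le (a *: x) (a * t) (SZ _ _ Sx) (mulr_ge0 (ltW a0) t0)) _.
  rewrite -scalerA -scalerDr.
  by have := qs.2 _ _ a0 (SD _ _ Sx (SZ t _ Sy)); lra.
Qed.

(** A minimal sublinear functional below [p], given by the Zorn lemma, is linear:
    [sublinear_on_dir] makes it additive.  The functionals only matter on the
    subspace [S]; this makes the order a preorder and lets the ambient module
    be a space of all functions. *)
Lemma dominated_linear p : sublinear_on R V S p ->
  exists L : V -> R, [/\ forall x y, S x -> S y -> L (x + y) = L x + L y,
    forall a x, S x -> L (a *: x) = a * L x & forall x, S x -> L x <= p x].
Proof.
move=> ps.
pose T := {q : V -> R | sublinear_on R V S q /\ forall x, S x -> q x <= p x}.
pose t0 : T := exist _ p (conj ps (fun x _ => lexx (p x))).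
pose rl (q1 q2 : T) := `[< forall x, S x -> sval q2 x <= sval q1 x >].
have [||A Atot|[q [qs qp]] qmin] := @ZL_preorder T t0 rl.
- by move=> t; apply/asboolP => x _.
- move=> r s t /asboolP rs /asboolP st; apply/asboolP => x Sx.
  exact: le_trans (st x Sx) (rs x Sx).
- have [->|/set0P[q0 Aq0]] := eqVneq A set0; first by exists t0 => s [].
  have lb x : S x -> has_lbound [set q x | q in [set sval q | q in A]].
    move=> Sx; exists (- p (- x)) => _ [_ [[q [qs qp]] Aq <-] <-] /=.
    apply: le_trans _ (sublinear_on_opp _ _ qs Sx).
    by rewrite lerN2; exact/qp/SN.
  set r := fun x => inf [set q x | q in [set sval q | q in A]].
  have rle q x : S x -> A q -> r x <= sval q x.
    by move=> Sx Aq; apply: ge_inf; [exact: lb|exists (sval q) => //; exists q].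
  have rP : sublinear_on R V S r /\ forall x, S x -> r x <= p x.
    split; last by move=> x Sx; apply: le_trans (rle _ _ Sx Aq0) _; exact: (svalP q0).2.
    apply: (sublinear_on_inf _ (sval q0)) => //.
    + by exists q0.
    + by move=> _ [[q [qs qp]] _ <-].
    + move=> _ _ [q1 Aq1 <-] [q2 Aq2 <-].
      by have [/asboolP|/asboolP] := Atot _ _ Aq1 Aq2; [right|left].
  by exists (exist _ r rP) => s As; apply/asboolP => x Sx /=; exact: rle.
have qD x y : S x -> S y -> q (x + y) = q x + q y.
  move=> Sx Sy; apply/eqP; rewrite eq_le qs.1//=.
  have [q's q'q q'y] := sublinear_on_dir _ _ qs Sy.
  set q' := (fun x => _) in q's q'q q'y.
  have q'P : sublinear_on R V S q' /\ forall x, S x -> q' x <= p x.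
    by split => // z Sz; exact: le_trans (q'q z Sz) (qp z Sz).
  have /asboolP/(_ x Sx)/= := qmin (exist _ q' q'P)
    (ltac:(by apply/asboolP => z Sz /=; exact: q'q)).
  by have := q'y x Sx; lra.
have qN x : S x -> q (- x) = - q x.
  move=> Sx; have := qD _ _ Sx (SN _ Sx); rewrite subrr (sublinear_on0 q x)//.
  by lra.
have qZ a x : 0 < a -> S x -> q (a *: x) = a * q x.
  move=> a0 Sx; apply/eqP; rewrite eq_le qs.2//=.
  have := qs.2 a^-1 (a *: x); rewrite scalerA mulVf ?gt_eqF// scale1r invr_gt0.
  by move=> /(_ a0 (SZ _ _ Sx)); rewrite ler_pdivlMl.
exists q; split => // a x Sx.
have [a0|a0|->] := ltgtP a 0; last 2 first.
- exact: qZ.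
- by rewrite scale0r mul0r (sublinear_on0 q x).
- by rewrite -[a]opprK scaleNr qN ?qZ ?oppr_gt0//; [rewrite !mulNr|exact: SZ].
Qed.

End sublinear.

(** * Random binary words with prescribed cylinder probabilities *)

(** Functions of a word of fixed length are finite combinations of indicators of
    cylinders; integrals and linear functionals are compared through this. *)
Lemma sum_words (R : realType) (T : Type) n (F : T -> seq bool) (g : seq bool -> R) t :
  size (F t) = n ->
  g (F t) = \sum_(w : n.-tuple bool) g w * (F t == w)%:R.
Proof.
move=> /eqP Fn; rewrite (bigD1 (Tuple Fn))//= eqxx mulr1 big1 ?addr0// => w.
move=> wF; case: eqVneq; rewrite ?mulr0// => E; case/eqP: wF.
exact/val_inj/esym.
Qed.

Section interval_tree.
Context (R : realType) (q : seq bool -> R).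

(** Words are stored with their latest letter first.  The words of length [n]
    label consecutive intervals of lengths [q w] that tile [0, 1), and each
    interval is split between the two one-letter extensions of its label;
    this is the left end of the interval labelled [w]. *)
Fixpoint tree_left (w : seq bool) : R :=
  if w is b :: w' then tree_left w' + (if b then q (false :: w') else 0) else 0.

Fixpoint tree_word (n : nat) (u : R) : seq bool :=
  if n is m.+1 then
    let w := tree_word m u in (tree_left (true :: w) <= u) :: w
  else [::].

Hypothesis q_ge0 : forall w, 0 <= q w.
Hypothesis q_nil : q [::] = 1.
Hypothesis q_cons : forall w, q w = q (false :: w) + q (true :: w).

Lemma tree_left_ge0 w : 0 <= tree_left w.
Proof. by elim: w => [|[] w IH]//=; rewrite ?addr0 ?addr_ge0. Qed.

Lemma tree_right_le1 w : tree_left w + q w <= 1.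
Proof.
elim: w => [|b w IH]/=; first by rewrite q_nil add0r.
apply: le_trans IH; rewrite (q_cons w).
by case: b; have := q_ge0 (true :: w); lra.
Qed.

Lemma tree_wordE w u : 0 <= u < 1 ->
  (tree_word (size w) u == w) = (tree_left w <= u < tree_left w + q w).
Proof.
move=> u01; elim: w => [|b w IH] /=; first by rewrite q_nil add0r u01.
rewrite eqseq_cons; have [wE|wE] := eqVneq (tree_word (size w) u) w.
  rewrite wE andbT.
  move: IH; rewrite wE eqxx => /esym/andP[wu uw].
  move: uw; rewrite (q_cons w) => uw.
  by case: b => /=; [have -> : u < tree_left w + q (false :: w) + q (true :: w) by lra|
    rewrite !addr0 wu /= ltNge]; case: leP.
rewrite andbF; apply/esym/negbTE; move: wE; rewrite IH.
apply: contra => /andP[]; rewrite (q_cons w).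
have := q_ge0 (true :: w); have := q_ge0 (false :: w).
by case: b => /= *; apply/andP; split; lra.
Qed.
End interval_tree.

Definition unif01 (R : realType) : set (mline R) -> \bar R :=
  mrestr (@lebesgue_measure R) (measurable_itv `[0%R, 1%R[).

HB.instance Definition _ (R : realType) := Measure.on (@unif01 R).

Lemma unif01_setT (R : realType) : @unif01 R setT = 1%E.
Proof. by rewrite /unif01/mrestr setTI lebesgue_measure_itv/= lte_fin ltr01 sube0. Qed.

HB.instance Definition _ (R : realType) :=
  @Measure_isProbability.Build _ _ R (@unif01 R) (@unif01_setT R).

(** Kolmogorov extension on the binary tree: [W n u] is the label of the [n]-th
    generation interval that contains [u], for [u] uniform in [0, 1). *)
Lemma random_word (R : realType) (q : seq bool -> R) :
  (forall w, 0 <= q w) -> q [::] = 1 ->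
  (forall w, q w = q (false :: w) + q (true :: w)) ->
  exists (P : probability (mline R) R) (W : nat -> mline R -> seq bool),
  [/\ forall u, W 0%N u = [::], forall n u, exists b, W n.+1 u = b :: W n u,
    forall w, measurable [set u | W (size w) u == w] &
    forall w, P [set u | W (size w) u == w] = (q w)%:E].
Proof.
move=> q0 q1 qD.
exists (@unif01 R), (tree_word R q); split => //.
- by move=> n u; eexists; reflexivity.
- elim => [|b w IH] /=.
    by rewrite (_ : [set _ | _] = setT)//; apply/seteqP; split.
  rewrite (_ : [set _ | _] = [set u | tree_word R q (size w) u == w] `&`
     [set u | (tree_left R q (true :: w) <= u) == b]); last first.
    apply/seteqP; split => u /=; rewrite eqseq_cons.
      by move=> /andP[+ /eqP wE]; rewrite wE.
    by move=> [/eqP -> ->]; rewrite eqxx.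
  apply: measurableI => //.
  case: b; [rewrite (_ : [set _ | _] = `[tree_left R q (true :: w), +oo[%classic)
    |rewrite (_ : [set _ | _] = `]-oo, tree_left R q (true :: w)[%classic)] => //.
    by apply/seteqP; split => u /=; rewrite in_itv /= andbT eqb_id.
  by apply/seteqP; split => u /=; rewrite in_itv /= eqbF_neg -ltNge.
- move=> w.
  transitivity (@lebesgue_measure R
    ([set u | tree_word R q (size w) u == w] `&` `[0%R, 1%R[%classic)) => //.
  rewrite (_ : _ `&` _ = `[tree_left R q w, tree_left R q w + q w[%classic).
    rewrite lebesgue_measure_itv/= lte_fin ltrDl.
    have [wp|] := ltP 0 (q w); first by rewrite -EFinB addrAC subrr add0r.
    by move=> w0; congr EFin; apply/le_anti; rewrite q0 w0.
  apply/seteqP; split => u /=; rewrite !in_itv/=.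
    by move=> [+ u01]; rewrite tree_wordE.
  move=> wu; have u01 : 0 <= u < 1.
    have := tree_left_ge0 R q q0 w; have := tree_right_le1 R q q0 q1 qD w.
    by move: wu => /andP[]; lra.
  by rewrite tree_wordE.
Qed.

(** * Dyadic cells of the unit square and lower semicontinuous costs *)

Section cells.
Context {R : realType}.
Implicit Types (x y u : R) (w : seq bool) (n : nat).

Definition dyad n : R := 2^-1 ^+ n.

Lemma dyadS n : dyad n = dyad n.+1 + dyad n.+1.
Proof. by rewrite /dyad exprSr; lra. Qed.

Lemma dyad_gt0 n : 0 < dyad n.
Proof. by rewrite exprn_gt0. Qed.

Lemma cvg_dyad : dyad @ \oo --> 0.
Proof. by apply: cvg_expr; rewrite ger0_norm; lra. Qed.

(** Odd-numbered bits refine the abscissa and even-numbered ones the ordinate, so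
    that [n] bits halve the width [uphalf n] times and the height [n./2] times. *)
Definition cell_width n := dyad (uphalf n).
Definition cell_height n := dyad n./2.

Lemma cell_width_small e : 0 < e -> \forall n \near \oo, cell_width n < e.
Proof.
move=> e0; have [N _ NP] : \forall n \near \oo, dyad n < e.
  by apply: (cvgr_lt 0) => //; exact: cvg_dyad.
exists N.*2 => // n /= Nn; apply: NP => /=.
by rewrite geq_uphalf_double ltnW.
Qed.

Lemma cell_height_small e : 0 < e -> \forall n \near \oo, cell_height n < e.
Proof.
move=> e0; have [N _ NP] : \forall n \near \oo, dyad n < e.
  by apply: (cvgr_lt 0) => //; exact: cvg_dyad.
by exists N.*2 => // n /= Nn; apply: NP => /=; rewrite geq_half_double.
Qed.

Fixpoint cellx w : R := if w is b :: w' then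
  cellx w' + (if b && ~~ odd (size w') then dyad (size w')./2.+1 else 0) else 0.
Fixpoint celly w : R := if w is b :: w' then
  celly w' + (if b && odd (size w') then dyad (size w')./2.+1 else 0) else 0.

(** Cells are closed, so that they still contain the limits of points
    of smaller cells. *)
Definition cell w := [set p : R * R |
  cellx w <= p.1 <= cellx w + cell_width (size w) /\
  celly w <= p.2 <= celly w + cell_height (size w)].

Lemma cell_cons b w : cell (b :: w) `<=` cell w.
Proof.
move=> [x y]; rewrite /cell /= /cell_width /cell_height /=.
have := @dyad_gt0 (size w)./2.+1.
have E := dyadS (size w)./2.
rewrite uphalf_half; case: odd; case: b => /=; rewrite ?addn0 ?add0n ?add1n ?addr0.
all: move=> h0 [/andP[? ?] /andP[? ?]]; split; apply/andP; split; lra.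
Qed.

Definition unit_square := [set p : R * R | 0 <= p.1 <= 1 /\ 0 <= p.2 <= 1].

Lemma unit_squareE : unit_square = `[0, 1]%classic `*` `[0, 1]%classic.
Proof.
by apply/seteqP; split => p [] /=; rewrite !in_itv /= => ? ?; split; rewrite /= ?in_itv.
Qed.

Lemma cell_nil : cell [::] = unit_square.
Proof. by rewrite /cell /= /cell_width /cell_height /= /dyad expr0 !add0r. Qed.

Lemma cell_sub w : cell w `<=` unit_square.
Proof.
elim: w => [|b w IH]; first by rewrite cell_nil.
by apply: subset_trans IH; exact: cell_cons.
Qed.

Lemma cell_corner w : cell w (cellx w, celly w).
Proof. by split; rewrite /= lexx lerDl ltW// dyad_gt0. Qed.

(** The bits are chosen greedily, from the corner of the current cell; the
    coordinate 1 then gets only ones, and needs no separate treatment. *)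
Fixpoint code n (p : R * R) : seq bool := if n is m.+1 then
    let w := code m p in
    (if odd m then celly w + dyad m./2.+1 <= p.2
     else cellx w + dyad m./2.+1 <= p.1) :: w
  else [::].

Lemma size_code n p : size (code n p) = n.
Proof. by elim: n => //= n ->. Qed.

Lemma cell_code n p : unit_square p -> cell (code n p) p.
Proof.
move=> p01; elim: n => [|n] /=; first by rewrite cell_nil.
rewrite /cell /= size_code /cell_width /cell_height /=.
have E := dyadS n./2.
rewrite uphalf_half; case: odd => /=; rewrite ?add0n ?add1n ?andbF ?andbT ?addr0.
  move=> [/andP[? ?] /andP[? ?]].
  by case: (lerP (celly (code n p) + dyad n./2.+1) p.2) => /= ?; rewrite ?addr0; split;
    apply/andP; split; lra.
move=> [/andP[? ?] /andP[? ?]].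
by case: (lerP (cellx (code n p) + dyad n./2.+1) p.1) => /= ?; rewrite ?addr0; split;
  apply/andP; split; lra.
Qed.

(** One coordinate of the corner of the coded cell, as a function of that
    coordinate alone: this is what makes it computable from one marginal. *)
Fixpoint digits n x : R := if n is m.+1 then
    let a := digits m x in if a + dyad m.+1 <= x then a + dyad m.+1 else a
  else 0.

Lemma cellx_code n p : cellx (code n p) = digits (uphalf n) p.1.
Proof.
elim: n => // n IH; rewrite /= size_code IH uphalf_half.
by case: odd => /=; rewrite ?add0n ?add1n ?andbF ?andbT ?addr0//; case: ifP;
  rewrite ?addr0.
Qed.

Lemma celly_code n p : celly (code n p) = digits n./2 p.2.
Proof.
elim: n => // n IH; rewrite /= size_code IH uphalf_half.
by case: odd => /=; rewrite ?add0n ?add1n ?andbF ?andbT ?addr0//; case: ifP;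
  rewrite ?addr0.
Qed.

Lemma measurable_digits n : measurable_fun setT (digits n : mline R -> mline R).
Proof.
elim: n => [|n IH] /=; first exact: measurable_cst.
apply: measurable_fun_ifT => //.
- by apply: measurable_fun_ler => //; exact: measurable_funD.
- exact: measurable_funD.
Qed.

Lemma measurable_code w : measurable [set p : mplane R | code (size w) p == w].
Proof.
elim: w => [|b w IH] /=.
  by rewrite (_ : [set _ | _] = setT)//; apply/seteqP; split.
rewrite (_ : [set _ | _] = [set p : mplane R | code (size w) p == w] `&`
   [set p | (if odd (size w) then celly w + dyad (size w)./2.+1 <= p.2
             else cellx w + dyad (size w)./2.+1 <= p.1) == b]); last first.
  apply/seteqP; split => p /=; rewrite eqseq_cons.
    by move=> /andP[+ /eqP wE]; rewrite wE.
  by move=> [/eqP -> ->]; rewrite eqxx.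
apply: measurableI => //.
pose h (p : mplane R) := if odd (size w) then celly w + dyad (size w)./2.+1 <= p.2
             else cellx w + dyad (size w)./2.+1 <= p.1.
have mh : measurable_fun setT h.
  by rewrite /h; case: odd; apply: measurable_fun_ler => //; exact: measurable_cst.
rewrite (_ : [set _ | _] = setT `&` h @^-1` [set b]); first exact: mh.
by rewrite setTI; apply/seteqP; split => p /= /eqP.
Qed.

(** The corners increase and the opposite corners decrease along a growing word,
    so the corners converge to a point of all the cells. *)
Lemma nested_limit (W : nat -> seq bool) :
  W 0%N = [::] -> (forall n, exists b, W n.+1 = b :: W n) ->
  [/\ cellx \o W @ \oo --> limn (cellx \o W), celly \o W @ \oo --> limn (celly \o W) &
      forall n, cell (W n) (limn (cellx \o W), limn (celly \o W))].
Proof.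
move=> W0 WS.
have sz n : size (W n) = n by elim: n => [|n IH]; [rewrite W0|have [b ->] := WS n;
  rewrite /= IH].
have sub m n : (m <= n)%N -> cell (W n) `<=` cell (W m).
  move=> /subnK <-; elim: (n - m)%N => // k IH.
  by rewrite addSn; have [b ->] := WS (k + m)%N;
    exact: subset_trans (@cell_cons _ _) IH.
have cn m n : (m <= n)%N -> cell (W m) (cellx (W n), celly (W n)).
  by move=> mn; apply: (sub m n mn); exact: cell_corner.
have ndx : nondecreasing_seq (cellx \o W).
  by move=> m n mn; have [/= /andP[]] := cn m n mn.
have ndy : nondecreasing_seq (celly \o W).
  by move=> m n mn; have [/= _ /andP[]] := cn m n mn.
have cx : cvgn (cellx \o W).
  apply: nondecreasing_is_cvgn => //; exists 1 => _ [n _ <-] /=.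
  by have := @cell_sub (W n) _ (cell_corner _) => -[/= /andP[]].
have cy : cvgn (celly \o W).
  apply: nondecreasing_is_cvgn => //; exists 1 => _ [n _ <-] /=.
  by have := @cell_sub (W n) _ (cell_corner _) => -[/= _ /andP[]].
split => // n; split => /=; apply/andP; split.
- exact: (nondecreasing_cvgn_le ndx).
- apply: limr_le => //; exists n => // m /= nm.
  by have [/= /andP[]] := cn n m nm.
- exact: (nondecreasing_cvgn_le ndy).
- apply: limr_le => //; exists n => // m /= nm.
  by have [/= _ /andP[]] := cn n m nm.
Qed.

Definition cell_inf (c : R -> R -> R) w := inf [set c p.1 p.2 | p in cell w].

Definition lsc_square (c : R -> R -> R) := forall p r, unit_square p -> r < c p.1 p.2 ->
  exists2 e, 0 < e & forall p', unit_square p' -> `|p'.1 - p.1| < e -> `|p'.2 - p.2|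
    < e ->
    r < c p'.1 p'.2.

(** Near each point the cost exceeds its value there minus 1; compactness of the
    square makes the bound uniform. *)
Lemma lsc_lower_bound c : lsc_square c ->
  exists M, forall p, unit_square p -> - M <= c p.1 p.2.
Proof.
move=> lsc.
have K : compact (`[0, 1] `*` `[0, 1] : set (R * R)) by apply: compact_setX;
  exact: segment_compact.
have /compact_near_coveringP/(_ nat \oo (fun n p => unit_square p -> - n%:R <= c p.1
  p.2)) := K.
case.
  move=> p [/= p1 p2]; have up : unit_square p by move: p1 p2; rewrite !in_itv.
  have [e e0 he] := lsc p (c p.1 p.2 - 1) up (ltac:(lra)).
  have n1 : \forall p' \near p, `|p'.1 - p.1| < e.
    have h : z.1 @[z --> p] --> p.1 by exact: cvg_fst.
    exact: (cvgr_distC_lt _ _ h _ e0).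
  have n2 : \forall p' \near p, `|p'.2 - p.2| < e.
    have h : z.2 @[z --> p] --> p.2 by exact: cvg_snd.
    exact: (cvgr_distC_lt _ _ h _ e0).
  have n3 : \forall n \near \oo, - n%:R <= c p.1 p.2 - 1.
    have := @nbhs_infty_ger R (- (c p.1 p.2 - 1)).
    by apply: filterS => n; lra.
  near=> p' n => up'.
  have : c p.1 p.2 - 1 < c p'.1 p'.2 by apply: he => //; near: p'.
  have : - n%:R <= c p.1 p.2 - 1 by near: n.
  lra.
move=> n _ /(_ n (leqnn n)) h; exists n%:R => p up; apply: h => //.
Unshelve. all: by end_near.
Qed.

Lemma cell_inf_le c w p M : (forall p, unit_square p -> - M <= c p.1 p.2) ->
  cell w p -> cell_inf c w <= c p.1 p.2.
Proof.
move=> cM wp; apply: ge_inf; last by exists p.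
by exists (- M) => _ [p' /cell_sub/cM ? <-].
Qed.

Lemma cell_inf_ge c w r : (forall p, cell w p -> r <= c p.1 p.2) -> r <= cell_inf c w.
Proof.
move=> h; apply: lb_le_inf; last by move=> _ [p /h ? <-].
by exists (c (cellx w) (celly w)), (cellx w, celly w) => //; exact: cell_corner.
Qed.

(** Lower semicontinuity says that the infima over shrinking neighbourhoods reach
    the value at the point.  Thus [cell_inf c] is a discretization of [c] from
    below. *)
Lemma cvg_cell_inf c (W : nat -> seq bool) p : lsc_square c ->
  (forall n, size (W n) = n) -> (forall n, cell (W n) p) ->
  (fun n => cell_inf c (W n)) @ \oo --> c p.1 p.2.
Proof.
move=> lsc sz Wp; have up : unit_square p by exact: (cell_sub _ _ (Wp 0%N)).
have [M cM] := lsc_lower_bound _ lsc.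
apply/cvgrPdist_le => e e0.
have [d d0 hd] := lsc p (c p.1 p.2 - e) up (ltac:(lra)).
near=> n.
(* Above, the cell contains p; below, it lies in the neighbourhood given by d. *)
have hl : cell_inf c (W n) <= c p.1 p.2 by exact: cell_inf_le cM _.
have hg : c p.1 p.2 - e <= cell_inf c (W n).
  apply: cell_inf_ge => p' Wp'.
  have w1 : cell_width n < d by near: n; exact: cell_width_small.
  have w2 : cell_height n < d by near: n; exact: cell_height_small.
  have := Wp n; move: (Wp'); rewrite /cell /= sz => -[/andP[a1 a2] /andP[a3 a4]]
    [/andP[b1 b2] /andP[b3 b4]].
  apply/ltW/hd; first exact: cell_sub _ _ Wp'.
  - by rewrite ltr_norml; apply/andP; split; lra.
  - by rewrite ltr_norml; apply/andP; split; lra.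
by rewrite ler_norml; apply/andP; split; lra.
Unshelve. all: by end_near.
Qed.
End cells.

(** * The functional dual to the transport problem *)

Section bounded_measurable_functions.
Context {R : realType}.
Local Notation I01 := (`[0%R, 1%R]%classic : set (mline R)).

Definition bounded_measurable (u : R -> R) :=
  measurable_fun setT (u : mline R -> mline R) /\ exists M, forall x, `|u x| <= M.

Lemma bounded_measurableD u v : bounded_measurable u -> bounded_measurable v ->
  bounded_measurable (fun x => u x + v x).
Proof.
move=> [mu [M uM]] [mv [N vN]]; split; first exact: measurable_funD.
by exists (M + N) => x; apply: le_trans (ler_normD _ _) _; exact: lerD.
Qed.

Lemma bounded_measurableZ a u : bounded_measurable u -> bounded_measurable (fun x =>
  a * u x).
Proof.
move=> [mu [M uM]]; split; first exact: measurable_funM.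
by exists (`|a| * M) => x; rewrite normrM ler_wpM2l.
Qed.

Lemma bounded_measurable_cst a : bounded_measurable (fun=> a).
Proof. by split; [exact: measurable_cst|exists `|a|]. Qed.

Context (mu : {measure set (mline R) -> \bar R}) (mu1 : mu I01 = 1%E).

Lemma bounded_measurable_integrable u : bounded_measurable u -> mu.-integrable I01
  (EFin \o u).
Proof.
move=> [mu_ [M uM]]; apply: measurable_bounded_integrable => //.
- by rewrite mu1 ltry.
- exact: measurable_funTS.
- exists M; split; first exact: num_real.
  by move=> N MN x _ /=; apply: le_trans (uM x) (ltW MN).
Qed.

Definition mean u := \int[mu]_(x in I01) u x.

Lemma meanE u : bounded_measurable u -> (\int[mu]_(x in I01) (u x)%:E = (mean u)%:E)%E.
Proof.
move=> bu; rewrite /mean /Rintegral fineK//.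
exact: (integrable_fin_num _ (bounded_measurable_integrable _ bu)).
Qed.

Lemma meanD u v : bounded_measurable u -> bounded_measurable v ->
  mean (fun x => u x + v x) = mean u + mean v.
Proof. by move=> bu bv; rewrite /mean RintegralD//;
  exact: bounded_measurable_integrable. Qed.

Lemma meanZ a u : bounded_measurable u -> mean (fun x => a * u x) = a * mean u.
Proof. by move=> bu; rewrite /mean RintegralZl//;
  exact: bounded_measurable_integrable. Qed.

Lemma mean_cst a : mean (fun=> a) = a.
Proof. by rewrite /mean Rintegral_cst// mu1 mulr1. Qed.

Lemma le_mean u v : bounded_measurable u -> bounded_measurable v ->
  (forall x, 0 <= x <= 1 -> u x <= v x) ->
  mean u <= mean v.
Proof.
move=> bu bv uv; apply: le_Rintegral => //; try exact: bounded_measurable_integrable.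
Qed.

End bounded_measurable_functions.

Section dual_functional.
Context (R : realType) (mu nu : {measure set (mline R) -> \bar R}).
Local Notation I01 := (`[0%R, 1%R]%classic : set (mline R)).
Hypothesis mu1 : mu I01 = 1%E.
Hypothesis nu1 : nu I01 = 1%E.
Variables (c : R -> R -> R) (D : R).
Local Notation sq := (@unit_square R).

(** Integrate the inequality in one variable, then in the other.  This replaces
    the product coupling in the weak duality for bounded functions. *)
Lemma mean_gap_ge M u v : bounded_measurable u -> bounded_measurable v ->
  (forall p, sq p -> - M <= u p.1 - v p.2) -> - M <= mean mu u - mean nu v.
Proof.
move=> bu bv uv.
suff : mean nu v <= mean mu u + M by lra.
rewrite -[leRHS](mean_cst _ nu1).
apply: le_mean => //; first exact: bounded_measurable_cst.
move=> y y01; rewrite -lerBlDr -[leLHS](mean_cst _ mu1).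
apply: le_mean => //; first exact: bounded_measurable_cst.
by move=> x x01; have := uv (x, y) (conj x01 y01) => /=; lra.
Qed.

Hypothesis dual_le : forall u v, bounded_measurable u -> bounded_measurable v ->
  (forall p, sq p -> u p.1 - v p.2 <= c p.1 p.2) -> mean mu u - mean nu v <= D.

Definition bounded_on_square := [set h : R * R -> R | exists M, forall p, sq p -> `|h
  p| <= M].

(** The values of the functions [u - v + t c] that dominate [h], computed as if the
    integral of [c] were [D].  Their infimum is the sublinear functional to which
    the Hahn-Banach theorem is applied; the term [t c] is there to force
    [L h <= D] for all [h <= c] at once. *)
Definition majorant_values (h : R * R -> R) : set R := [set r | exists u v t,
  [/\ bounded_measurable u, bounded_measurable v, 0 <= t,
     forall p, sq p -> h p <= u p.1 - v p.2 + t * c p.1 p.2 &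
     r = mean mu u - mean nu v + t * D]].

(** For [t > 0], divide by [t]: if [- M <= h] then [(- (u + M) / t, - v / t)] is
    a dual pair for [c], so the assumption on [D] applies to it. *)
Lemma majorant_values_ge h M r : (forall p, sq p -> - M <= h p) ->
  majorant_values h r -> - M <= r.
Proof.
move=> hM [u [v [t [bu bv t0 hle ->]]]].
have [te|tn0] := eqVneq t 0.
  rewrite te mul0r addr0; apply: mean_gap_ge => // p sp.
  by have := hle p sp; have := hM p sp; rewrite te; lra.
have {}t0 : 0 < t by rewrite lt_def tn0.
have := @dual_le (fun x => - t^-1 * (u x + M)) (fun x => - t^-1 * v x).
rewrite !meanZ ?meanD ?mean_cst//;
  try (exact: bounded_measurableZ || exact: bounded_measurable_cst).
  move=> H; rewrite -(ler_pM2l (ltac:(by rewrite invr_gt0): 0 < t^-1)) mulrDr mulrA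
    mulVf// mul1r.
  suff : - t^-1 * (mean mu u + M) - - t^-1 * mean nu v <= D by lra.
  apply: H => //; [by apply/bounded_measurableZ/bounded_measurableD => //;
    exact: bounded_measurable_cst|exact: bounded_measurableZ|].
  move=> p sp; rewrite -(ler_pM2l t0).
  have -> : t * (- t^-1 * (u p.1 + M) - - t^-1 * v p.2) = v p.2 - u p.1 - M by field.
  by have := hle p sp; have := hM p sp; lra.
by apply/bounded_measurableD => //; exact: bounded_measurable_cst.
Qed.

Let S := bounded_on_square.

Lemma bounded_on_squareD h g : S h -> S g -> S (h + g).
Proof.
move=> [M hM] [N gN]; exists (M + N) => p sp.
by apply: le_trans (ler_normD _ _) _; apply: lerD; [exact: hM|exact: gN].
Qed.

Lemma bounded_on_squareZ a h : S h -> S (a *: h).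
Proof.
move=> [M hM]; exists (`|a| * M) => p sp.
by rewrite [X in `|X|](_ : _ = a * h p)// normrM ler_wpM2l//; exact: hM.
Qed.

Lemma majorant_values_neq0 h : S h -> majorant_values h !=set0.
Proof.
move=> [M hM]; exists M, (fun=> M), (fun=> 0), 0; split => //;
  try exact: bounded_measurable_cst.
- by move=> p sp; rewrite subr0 mul0r addr0; exact: le_trans (ler_norm _) (hM p sp).
- by rewrite !mean_cst// subr0 mul0r addr0.
Qed.

Lemma majorant_values_lb h : S h -> has_lbound (majorant_values h).
Proof.
move=> [M hM]; exists (- M) => r; apply: majorant_values_ge => p sp.
by have := hM p sp; rewrite ler_norml => /andP[].
Qed.

Lemma inf_majorant_values_sublinear :
  sublinear_on R (R * R -> R)%type S (fun h => inf (majorant_values h)).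
Proof.
split.
- move=> h g Sh Sg /=.
  rewrite -lerBlDr; apply: lb_le_inf => [|_ [u [v [t [bu bv t0 hh ->]]]]];
    first exact: majorant_values_neq0.
  rewrite lerBlDr -lerBlDl; apply: lb_le_inf => [|_ [u' [v' [t' [bu' bv' t'0 gg
    ->]]]]]; first exact: majorant_values_neq0.
  rewrite lerBlDl; apply: ge_inf; first exact/majorant_values_lb/bounded_on_squareD.
  exists (fun x => u x + u' x), (fun x => v x + v' x), (t + t'); split;
    try exact: bounded_measurableD.
  + exact: addr_ge0.
  + by move=> p sp; rewrite [leLHS](_ : _ = h p + g p)//; have := hh p sp;
    have := gg p sp; lra.
  + by rewrite !meanD//; lra.
- move=> a h a0 Sh /=; rewrite -ler_pdivrMl//.
  apply: lb_le_inf => [|_ [u [v [t [bu bv t0 hh ->]]]]];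
    first exact: majorant_values_neq0.
  rewrite ler_pdivrMl//; apply: ge_inf;
    first exact/majorant_values_lb/bounded_on_squareZ.
  exists (fun x => a * u x), (fun x => a * v x), (a * t); split;
    try exact: bounded_measurableZ.
  + exact: mulr_ge0 (ltW a0) t0.
  + move=> p sp; rewrite [leLHS](_ : _ = a * h p)//.
    by rewrite -mulrA -mulrBr -mulrDr ler_pM2l//; exact: hh.
  + by rewrite !meanZ//; lra.
Qed.

(** The positive functional [L] plays the role of a finitely additive coupling:
    it has the right marginals and gives [c] an integral at most [D]. *)
Lemma dual_functional : exists L : (R * R -> R) -> R,
  [/\ forall h g, S h -> S g -> L (h + g) = L h + L g,
      forall a h, S h -> L (a *: h) = a * L h,
      forall h, S h -> (forall p, sq p -> 0 <= h p) -> 0 <= L h,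
      (forall u, bounded_measurable u -> L (fun p => u p.1) = mean mu u) /\
      (forall u, bounded_measurable u -> L (fun p => u p.2) = mean nu u) &
      forall h, S h -> (forall p, sq p -> h p <= c p.1 p.2) -> L h <= D].
Proof.
have [L [LD LZ Lle]] := @dominated_linear R (R * R -> R)%type S
  bounded_on_squareD bounded_on_squareZ _ inf_majorant_values_sublinear.
have Lb h r : S h -> majorant_values h r -> L h <= r.
  by move=> Sh hr; apply: le_trans (Lle h Sh) _; apply: ge_inf => //;
    exact: majorant_values_lb.
have LN h : S h -> L (- h) = - L h by move=> Sh; rewrite -scaleN1r LZ// mulN1r.
have S1 u : bounded_measurable u -> S (fun p => u p.1) by move=> [_ [M uM]];
  exists M => p _; exact: uM.
have S2 u : bounded_measurable u -> S (fun p => u p.2) by move=> [_ [M uM]];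
  exists M => p _; exact: uM.
have b0 : bounded_measurable (fun=> 0 : R) := bounded_measurable_cst 0.
have bN u : bounded_measurable u -> bounded_measurable (fun x => -1 * u x) by exact:
  bounded_measurableZ.
exists L; split => //.
- move=> h Sh h0; rewrite -lerN2 oppr0 -LN//; apply: Lb.
    by rewrite -scaleN1r; exact: bounded_on_squareZ.
  exists (fun=> 0), (fun=> 0), 0; split => //.
    by move=> p sp; rewrite [leLHS](_ : _ = - h p)//; have := h0 p sp; lra.
  by rewrite !mean_cst//; lra.
- split=> u bu.
  + apply/eqP; rewrite eq_le; apply/andP; split.
      apply: Lb; first exact: S1.
      exists u, (fun=> 0), 0; split => //; first by move=> p sp; lra.
      by rewrite mean_cst//; lra.
    rewrite -lerN2 -LN; last exact: S1.
    apply: Lb; first by rewrite -scaleN1r; exact/bounded_on_squareZ/S1.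
    exists (fun x => -1 * u x), (fun=> 0), 0; split => //; first exact: bN.
      by move=> p sp; rewrite [leLHS](_ : _ = - u p.1)//; lra.
    by rewrite mean_cst// meanZ//; lra.
  + apply/eqP; rewrite eq_le; apply/andP; split.
      apply: Lb; first exact: S2.
      exists (fun=> 0), (fun x => -1 * u x), 0; split => //; first exact: bN.
        by move=> p sp; lra.
      by rewrite mean_cst// meanZ//; lra.
    rewrite -lerN2 -LN; last exact: S2.
    apply: Lb; first by rewrite -scaleN1r; exact/bounded_on_squareZ/S2.
    exists (fun=> 0), u, 0; split => //.
      by move=> p sp; rewrite [leLHS](_ : _ = - u p.2)//; lra.
    by rewrite mean_cst//; lra.
- move=> h Sh hc; apply: Lb => //; exists (fun=> 0), (fun=> 0), 1; split => //.
    by move=> p sp; rewrite mul1r subr0 add0r; exact: hc.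
  by rewrite !mean_cst//; lra.
Qed.

End dual_functional.

(** * A coupling of cost at most the dual value *)

(** Right continuity of a distribution function, in the form used to remove the
    discretization error. *)
Lemma le_measure_sublevel d (T : measurableType d) (R : realType)
  (m : {measure set T -> \bar R}) (D : set T) (Z : T -> R) (t : R) (r : \bar R) :
  measurable D -> measurable_fun setT Z -> (m D < +oo)%E ->
  (forall e, 0 < e -> (r <= m (D `&` [set x | (Z x <= t + e)%R]))%E) ->
  (r <= m (D `&` [set x | (Z x <= t)%R]))%E.
Proof.
move=> mD mZ mDoo h.
have mF s : measurable (D `&` [set x | Z x <= s]).
  by apply: measurable_fun_le => //; exact: measurable_funTS.
pose F n := D `&` [set x | Z x <= t + n.+1%:R^-1].
have FE : \bigcap_n F n = D `&` [set x | Z x <= t].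
  apply/seteqP; split => x /=; last first.
    by move=> [Dx Zx] n _; split => //=; apply: le_trans Zx _; rewrite lerDl invr_ge0.
  move=> Fx; split; first exact: (Fx 0%N I).1.
  apply/ler_addgt0Pr => e e0; have [n _ /(_ n (leqnn n)) ne] := near_infty_natSinv_lt
    (PosNum e0).
  by apply: le_trans (Fx n I).2 _; rewrite lerD2l; exact: ltW ne.
have FD : (m (F 0%N) < +oo)%E.
  by apply: le_lt_trans mDoo; apply: le_measure; rewrite ?inE//;
    [exact: mF|move=> x []].
have := @nonincreasing_cvg_mu _ _ _ m F FD (fun n => mF _); rewrite FE.
move=> /(_ (mF t)); have niF : nonincreasing_seq F.
  move=> a b ab; rewrite subsetEset => x [Dx /= Zx]; split => //=; apply: le_trans Zx _.
  by rewrite lerD2l lef_pV2 ?posrE// ler_nat.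
move=> /(_ niF) cv; rewrite -(cvg_lim _ cv)//; apply: lime_ge; first by apply/cvg_ex;
  eexists; exact: cv.
by near=> n; apply: h; rewrite invr_gt0.
Unshelve. all: by end_near.
Qed.

Lemma digits_bounds (R : realType) n (x : R) : 0 <= x <= 1 ->
  digits n x <= x <= digits n x + dyad n.
Proof.
move=> x01; have [_] := @cell_code R n.*2 (x, x) (conj x01 x01).
by rewrite celly_code size_code /cell_height half_double.
Qed.

Lemma words_bounded (R : realType) n (g : seq bool -> R) :
  exists M, forall w, size w = n -> `|g w| <= M.
Proof.
exists (\sum_(w : n.-tuple bool) `|g w|) => w /eqP wn.
by rewrite (bigD1 (Tuple wn))//= lerDl sumr_ge0.
Qed.

Lemma measurable_words d (T : measurableType d) (R : realType) n (F : T -> seq bool)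
    (g : seq bool -> R) : (forall t, size (F t) = n) ->
  (forall w, size w = n -> measurable [set t | F t == w]) ->
  measurable_fun setT (fun t => g (F t)).
Proof.
move=> sF mF.
rewrite (_ : (fun _ => _) = fun t => \sum_(w : n.-tuple bool) g w * \1_[set t | F t
  == w] t); last first.
  apply/funext => t; rewrite (@sum_words R T n F g)//; apply: eq_bigr => w _.
  by rewrite indicE mem_setE.
apply: measurable_sum => w; apply: measurable_funM => //; apply: measurable_indic.
by apply: mF; rewrite size_tuple.
Qed.

Lemma integral_words d (T : measurableType d) (R : realType) (P : probability T R)
    n (F : T -> seq bool) (g q : seq bool -> R) : (forall t, size (F t) = n) ->
  (forall w, size w = n -> measurable [set t | F t == w]) ->
  (forall w, size w = n -> P [set t | F t == w] = (q w)%:E) ->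
  (\int[P]_t (g (F t))%:E = (\sum_(w : n.-tuple bool) g w * q w)%:E)%E.
Proof.
move=> sF mF Pq.
transitivity (\int[P]_t \sum_(w : n.-tuple bool) (g w * \1_[set t | F t == w] t)%:E)%E.
  apply: eq_integral => t _; rewrite (@sum_words R T n F g)// -sumEFin;
    apply: eq_bigr => w _.
  by rewrite indicE mem_setE.
have ig (w : n.-tuple bool) : P.-integrable setT (EFin \o \1_[set t | F t == w]).
  by apply: integrable_indic; exact: mF (size_tuple w).
rewrite integral_sum//; last first.
  by move=> w; rewrite (_ : (fun _ => _) = fun t => (g w)%:E * (\1_[set t | F t == w]
    t)%:E)%E//;
    apply: integrableZl => //; exact: ig.
rewrite -sumEFin; apply: eq_bigr => w _.
under eq_integral do rewrite EFinM.
rewrite integralZl//; last exact: ig.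
rewrite integral_indic//; last by apply: mF; rewrite size_tuple.
by rewrite setIT EFinM; congr (_ * _)%E; apply: Pq; rewrite size_tuple.
Qed.

Lemma measurable_unit_square (R : realType) : measurable (@unit_square R : set
  (mplane R)).
Proof. by rewrite unit_squareE; exact: measurableX. Qed.

Lemma measurable_lsc (R : realType) (c : R -> R -> R) : lsc_square c ->
  measurable_fun (@unit_square R : set (mplane R)) (fun p : mplane R => c p.1 p.2).
Proof.
move=> c_lsc.
apply: (@measurable_fun_cvg _ _ _ _ (fun n p => cell_inf c (code n p))) => [n|p sp].
  apply: measurable_funTS.
  apply: (@measurable_words _ _ R n (@code R n) (cell_inf c)) => [p|w <-];
    first exact: size_code.
  exact: measurable_code.
by apply: cvg_cell_inf => // n; [exact: size_code|exact: cell_code].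
Qed.

Section coupling.
Context (R : realType) (mu nu : {measure set (mline R) -> \bar R}).
Local Notation I01 := (`[0%R, 1%R]%classic : set (mline R)).
Hypothesis mu1 : mu I01 = 1%E.
Hypothesis nu1 : nu I01 = 1%E.
Variables (c : R -> R -> R) (D : R).
Local Notation sq := (@unit_square R).
Hypothesis c_lsc : lsc_square c.
Hypothesis dual_le : forall u v, bounded_measurable u -> bounded_measurable v ->
  (forall p, sq p -> u p.1 - v p.2 <= c p.1 p.2) -> mean mu u - mean nu v <= D.

Lemma functional_words (L : (R * R -> R) -> R) n (g : seq bool -> R) :
  (forall f h, bounded_on_square R f -> bounded_on_square R h -> L (f + h) = L f + L
    h) ->
  (forall a h, bounded_on_square R h -> L (a *: h) = a * L h) ->
  L (fun p : R * R => g (code n p)) =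
  \sum_(w : n.-tuple bool) g w * L (fun p : R * R => (code n p == w)%:R).
Proof.
move=> LD LZ.
have S1 w : bounded_on_square R (fun p : R * R => (code n p == w)%:R).
  by exists 1 => p _; case: eqP => _; rewrite ?normr1 ?normr0.
have -> : (fun p : R * R => g (code n p)) =
    \sum_(w : n.-tuple bool) g w *: (fun p : R * R => (code n p == w)%:R : R).
  rewrite funeqE => p; rewrite (@sum_words R _ n (code n) g) ?size_code//.
  by rewrite fct_sumE.
have [] : bounded_on_square R (\sum_(w : n.-tuple bool) g w *: (fun p : R * R =>
  (code n p == w)%:R : R)) /\
   L (\sum_(w : n.-tuple bool) g w *: (fun p : R * R => (code n p == w)%:R : R)) =
   \sum_(w : n.-tuple bool) g w * L (fun p : R * R => (code n p == w)%:R); last by [].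
elim/big_rec2: _ => [|w y1 y2 _ [Sy Ly]].
  split; first by exists 0 => p _ /=; rewrite normr0.
  by rewrite -(scale0r (fun p : R * R => (code n p == [::])%:R : R)) LZ// mul0r.
split; first by apply: bounded_on_squareD => //; exact: bounded_on_squareZ.
by rewrite LD ?LZ ?Ly//; exact: bounded_on_squareZ.
Qed.

(** The numbers [q w = L (indicator of the points coded by w)] are additive along
    the binary tree, so [random_word] realizes them by random words [W n]; the
    corners of their cells converge to a random point [(X, Y)], whose law is the
    coupling.  Functions of [W n] have the same mean under [P] as the coded
    functions under [L].  Applied to the discretized coordinates, which are
    within a cell of the true ones, this gives the marginals; applied to
    [cell_inf c], it gives the cost through the Fatou lemma.  No countable
    additivity of [L] is involved: the limit is taken on points, not on sets. *)
Lemma coupling_exists : exists pi : probability (mplane R) R,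
 [/\ pi sq = 1%E, forall t, pi [set p | p.1 <= t] = mu (I01 `&` [set x | x <= t]),
   forall t, pi [set p | p.2 <= t] = nu (I01 `&` [set x | x <= t]) &
   (\int[pi]_(p in sq) (c p.1 p.2)%:E <= D%:E)%E].
Proof.
have [L [LD LZ L0 [L1 L2] LC]] := @dual_functional R mu nu mu1 nu1 c D dual_le.
have Sb (h : R * R -> bool) : bounded_on_square R (fun p => (h p)%:R).
  by exists 1 => p _; case: (h p); rewrite ?normr1 ?normr0.
have Lcst (M : R) : L (fun=> M) = M.
  by rewrite (L1 (fun=> M)) ?mean_cst//; exact: bounded_measurable_cst.
pose q w := L (fun p => (code (size w) p == w)%:R).
have q0 w : 0 <= q w by apply: L0 => // p _; rewrite ler0n.
have q1 : q [::] = 1 by rewrite /q /= Lcst.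
have qS w : q w = q (false :: w) + q (true :: w).
  rewrite /q -LD//; congr L; apply/funext => p.
  rewrite [RHS](_ : _ = (code (size w).+1 p == false :: w)%:R + (code (size w).+1 p
    == true :: w)%:R)//=.
  by rewrite !eqseq_cons; case: (X in X == false); rewrite /= ?addr0 ?add0r.
have [P [W [W0 WS mW PW]]] := @random_word R q q0 q1 qS.
have sz n u : size (W n u) = n.
  by elim: n => [|n IH]; [rewrite W0|have [b ->] := WS n u; rewrite /= IH].
have mWn n w : size w = n -> measurable [set u | W n u == w] by move=> <-.
have mg n (g : seq bool -> R) : measurable_fun setT (fun u => g (W n u)).
  exact: (@measurable_words _ _ R n (W n) g (sz n) (mWn n)).
have transfer n (g : seq bool -> R) :
    (\int[P]_u (g (W n u))%:E = (L (fun p => g (code n p)))%:E)%E.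
  rewrite (@integral_words _ _ R P n (W n) g q (sz n) (mWn n)); last by move=> w <-.
  rewrite (functional_words L n g LD LZ); congr EFin; apply: eq_bigr => w _.
  by rewrite /q size_tuple.
pose X u := limn (cellx \o (fun n => W n u)) : R.
pose Y u := limn (celly \o (fun n => W n u)) : R.
have XYP u := @nested_limit R (fun n => W n u) (W0 u) (fun n => WS n u).
have mX : measurable_fun setT (X : mline R -> mline R).
  by apply: (@measurable_fun_cvg _ _ _ _ (fun n u => cellx (W n u))) => [n|u _];
    [exact: mg|have [] := XYP u].
have mY : measurable_fun setT (Y : mline R -> mline R).
  by apply: (@measurable_fun_cvg _ _ _ _ (fun n u => celly (W n u))) => [n|u _];
    [exact: mg|have [] := XYP u].
(* Both marginals at once: pr is a coordinate, cz the same coordinate of the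
   corner of a cell, and k n the number of bits of a word of length n which
   describe it. *)
have marg (m : {measure set (mline R) -> \bar R}) (pr : R * R -> R) (cz : seq bool -> R)
    (k : nat -> nat) (Z : mline R -> R) : m I01 = 1%E -> measurable_fun setT Z ->
    (forall u, bounded_measurable u -> L (fun p => u (pr p)) = mean m u) ->
    (forall n p, cz (code n p) = digits (k n) (pr p)) ->
    (forall e, 0 < e -> exists n, @dyad R (k n) < e) ->
    (forall n u, cz (W n u) <= Z u <= cz (W n u) + dyad (k n)) ->
    forall t, P [set u | Z u <= t] = m (I01 `&` [set x | x <= t]).
  move=> m1 mZ Lm czE ksmall Zb t.
  have mdig n s : measurable [set x : mline R | digits n x <= s].
    by rewrite -[X in measurable X]setTI; apply: measurable_fun_le => //;
      exact: measurable_digits.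
  have mcz n s : measurable [set u | cz (W n u) <= s].
    by rewrite -[X in measurable X]setTI; apply: measurable_fun_le => //; exact: mg.
  have mZs s : measurable [set u | Z u <= s].
    by rewrite -[X in measurable X]setTI; apply: measurable_fun_le.
  have E n s : P [set u | cz (W n u) <= s] = m (I01 `&` [set x | digits (k n) x <= s]).
    have bd : bounded_measurable (fun x : R => (digits (k n) x <= s)%R%:R : R).
      split; last by exists 1 => x; case: (_ <= s); rewrite ?normr1 ?normr0.
      rewrite (_ : (fun _ => _) = \1_[set x : mline R | digits (k n) x <= s]);
        last first.
        by apply/funext => x; rewrite indicE mem_setE.
      exact: measurable_indic.
    transitivity (\int[P]_u (((cz (W n u) <= s)%R%:R : R)%:E))%E.
      rewrite -(setIT [set u | _]) -integral_indic//; apply: eq_integral => u _.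
      by rewrite indicE mem_setE.
    rewrite (transfer n (fun w => (cz w <= s)%R%:R)).
    under eq_fun do rewrite czE.
    rewrite (Lm _ bd) -meanE// (setIC I01) -integral_indic//; apply: eq_integral => u _.
    by rewrite indicE mem_setE.
  apply/eqP; rewrite eq_le; apply/andP; split.
    apply: le_measure_sublevel => //; first by rewrite m1 ltry.
    move=> e e0; have [n ne] := ksmall e e0.
    apply: (@le_trans _ _ (P [set u | cz (W n u) <= t])).
      by apply: le_measure; rewrite ?inE// => u /=; have /andP[+ _] := Zb n u;
        exact: le_trans.
    rewrite E; apply: le_measure; rewrite ?inE; try exact: measurableI.
      by apply: measurableI => //; rewrite -[X in measurable X]setTI;
        apply: measurable_fun_le.
    move=> x [x01 /= xt]; split => //=; move: x01;
      rewrite /= in_itv /= => /(digits_bounds _ (k n))/andP[_]; lra.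
  rewrite -[leRHS](_ : P (setT `&` [set u | Z u <= t]) = _); last by rewrite setTI.
  apply: le_measure_sublevel => //;
    first exact: (le_lt_trans (probability_le1 P measurableT) (ltry 1)).
  move=> e e0; have [n ne] := ksmall e e0.
  rewrite setTI.
  apply: (@le_trans _ _ (P [set u | cz (W n u) <= t])); last first.
    by apply: le_measure; rewrite ?inE// => u /=; have /andP[_] := Zb n u; lra.
  rewrite E; apply: le_measure; rewrite ?inE; try exact: measurableI.
    by apply: measurableI => //; rewrite -[X in measurable X]setTI;
      apply: measurable_fun_le.
  move=> x [x01 /= xt]; split => //=; move: x01;
    rewrite /= in_itv /= => /(digits_bounds _ (k n))/andP[+ _]; lra.
have cellXY n u : cell (W n u) (X u, Y u) by have [_ _] := XYP u; apply.
have margX := marg mu fst (@cellx R) uphalf X mu1 mX L1 (fun n p => @cellx_code R n p).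
have {}margX : forall t, P [set u | X u <= t] = mu (I01 `&` [set x | x <= t]).
  apply: margX => [e e0|n u].
    by have [n _ /(_ n (leqnn n)) h] := @cell_width_small R e e0; exists n.
  by have [+ _] := cellXY n u; rewrite sz.
have margY := marg nu snd (@celly R) half Y nu1 mY L2 (fun n p => @celly_code R n p).
have {}margY : forall t, P [set u | Y u <= t] = nu (I01 `&` [set x | x <= t]).
  apply: margY => [e e0|n u].
    by have [n _ /(_ n (leqnn n)) h] := @cell_height_small R e e0; exists n.
  by have [_] := cellXY n u; rewrite sz.
pose XY (u : mline R) : mplane R := (X u, Y u).
have mXY : measurable_fun setT XY by exact: measurable_fun_pair.
pose XYm : {mfun mline R >-> mplane R} := HB.pack XY (isMeasurableFun.Build _ _ _ _ _
  mXY).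
have XYsq u : sq (XY u) by exact: cell_sub _ _ (cellXY 0%N u).
have preT : XY @^-1` sq = setT by apply/seteqP; split => // u _; exact: XYsq.
have msq := @measurable_unit_square R.
have [M cM] := lsc_lower_bound _ c_lsc.
have mc := @measurable_lsc R c c_lsc.
have cXY u : (fun n => cell_inf c (W n u)) @ \oo --> c (X u) (Y u).
  by have := @cvg_cell_inf R c (fun n => W n u) (X u, Y u) c_lsc (fun n => sz n u)
    (fun n => cellXY n u).
have cle n : (\int[P]_u (cell_inf c (W n u) + M)%:E <= (D + M)%:E)%E.
  rewrite (transfer n (fun w => cell_inf c w + M)).
  have [N hN] := @words_bounded R n (cell_inf c).
  have Sc : bounded_on_square R (fun p => cell_inf c (code n p)).
    by exists N => p _; apply: hN; exact: size_code.
  have SM : bounded_on_square R (fun=> M) by exists `|M|.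
  rewrite lee_fin -[X in X <= _]/(L ((fun p => cell_inf c (code n p)) + (fun=> M)))
    LD// Lcst lerD2r.
  by apply: LC => // p sp; apply: (cell_inf_le _ _ _ _ cM); exact: cell_code.
have inf_ge n u : 0 <= cell_inf c (W n u) + M.
  suff : - M <= cell_inf c (W n u) by lra.
  by apply: cell_inf_ge => p /cell_sub; exact: cM.
have mcXY : measurable_fun setT (fun u : mline R => c (X u) (Y u)).
  exact: (@measurable_fun_cvg _ _ _ _ (fun n u => cell_inf c (W n u))).
have fat : (\int[P]_u (c (X u) (Y u) + M)%:E <= (D + M)%:E)%E.
  (* Adding M makes the integrands nonnegative, as the Fatou lemma requires. *)
  pose f n u := (cell_inf c (W n u) + M)%:E.
  have flim u : limn_einf (f^~ u) = (c (X u) (Y u) + M)%:E.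
    apply: (cvg_limn_einf_sup _).1; apply: cvg_EFin; first exact: nearW.
    by apply: cvgD; [exact: cXY|exact: cvg_cst].
  under eq_integral do rewrite -flim.
  apply: le_trans (fatou _ _ _ _) _ => //.
  - by move=> n; apply/measurable_EFinP; exact: mg _ (fun w => cell_inf c w + M).
  - by move=> n u _; rewrite lee_fin.
  rewrite limn_einf_lim; apply: lime_le; first exact: is_cvg_einfs.
  near=> n; apply: le_trans (cle n); apply: ereal_inf_lbound; exists n => //=.
exists (distribution P XYm); split.
- by rewrite -[RHS](probability_setT P) -preT.
- by move=> t; rewrite -margX.
- by move=> t; rewrite -margY.
have mcM : measurable_fun sq (fun p : mplane R => (c p.1 p.2 + M)%:E).
  by apply/measurable_EFinP; exact: measurable_funD.
have int1 : (\int[distribution P XYm]_(p in sq) (c p.1 p.2 + M)%:E <= (D + M)%:E)%E.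
  rewrite /distribution ge0_integral_pushforward//; last first.
    by move=> p; rewrite inE lee_fin => /cM; lra.
  by rewrite [X in integral _ X](_ : _ = setT).
have PI : distribution P XYm sq = 1%E by rewrite -[RHS](probability_setT P) -preT.
have int2 : (distribution P XYm).-integrable sq (fun p : mplane R => (c p.1 p.2 +
  M)%:E).
  apply/integrableP; split => //.
  apply: le_lt_trans (ltry (D + M)); apply: le_trans int1.
  rewrite le_eqVlt; apply/orP; left; apply/eqP.
  apply: eq_integral => p.
  by rewrite inE => /cM pM; rewrite gee0_abs// lee_fin; lra.
have int3 : (distribution P XYm).-integrable sq (EFin \o (fun=> M)).
  by apply: finite_measure_integrable_cst.
rewrite (eq_integral (fun p : mplane R => (c p.1 p.2 + M)%:E - M%:E)%E); last first.
  by move=> p _; rewrite -EFinB addrK.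
rewrite integralB//.
rewrite integral_cst// [X in (_ * X)%E](_ : _ = 1%E); last exact: PI.
by rewrite mule1 leeBlDr.
Unshelve. all: by end_near.
Qed.
End coupling.

(** * Calculus of continuously differentiable functions *)

Section C1.
Context {R : realType}.

Definition C1 (V : normedModType R) (f : V -> R) :=
  (forall x, differentiable f x) /\ (forall v, continuous ('D_v f)).

Lemma C1_continuous (V : normedModType R) (f : V -> R) : C1 V f -> continuous f.
Proof. by move=> [df _] x; exact: differentiable_continuous. Qed.

Lemma C1_derivable (V : normedModType R) (f : V -> R) x v : C1 V f -> derivable f x v.
Proof. by move=> [df _]; exact: diff_derivable. Qed.

Lemma C1_cst (V : normedModType R) (a : R) : C1 V (fun=> a).
Proof.
split; first by move=> x; exact: differentiable_cst.
move=> v; rewrite (_ : 'D_v _ = fun=> 0); first by move=> x; exact: cvg_cst.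
by apply/funext => x; rewrite derive_cst.
Qed.

Lemma C1D (V : normedModType R) (f g : V -> R) : C1 V f -> C1 V g ->
  C1 V (fun x => f x + g x).
Proof.
move=> Cf Cg; split; first by move=> x; apply: differentiableD;
  [exact: Cf.1|exact: Cg.1].
move=> v; rewrite (_ : 'D_v _ = fun x => 'D_v f x + 'D_v g x).
  by move=> x; apply: cvgD; [exact: Cf.2|exact: Cg.2].
by apply/funext => x; rewrite deriveD//; exact: C1_derivable.
Qed.

Lemma C1M (V : normedModType R) (f g : V -> R) : C1 V f -> C1 V g ->
  C1 V (fun x => f x * g x).
Proof.
move=> Cf Cg; split; first by move=> x; apply: differentiableM;
  [exact: Cf.1|exact: Cg.1].
move=> v; rewrite (_ : 'D_v _ = fun x => f x * 'D_v g x + g x * 'D_v f x).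
  by move=> x; apply: cvgD; apply: cvgM;
    [exact: C1_continuous|exact: Cg.2|exact: C1_continuous|exact: Cf.2].
by apply/funext => x; rewrite deriveM//; exact: C1_derivable.
Qed.

(** The directional derivatives of [f \o fst] are those of [f] by mere unfolding,
    since addition and scaling in a product are componentwise. *)
Lemma C1_fst (V W : normedModType R) (f : V -> R) : C1 V f ->
  C1 (V * W)%type (fun p => f p.1).
Proof.
move=> [df Df]; split.
  move=> p; apply: (@differentiable_comp _ _ _ _ fst f); last exact: df.
  by apply: linear_differentiable => q; first [exact: cvg_fst|exact: cvg_snd].
move=> v; rewrite (_ : 'D_v _ = ('D_v.1 f) \o fst)//.
by move=> p; apply: continuous_comp; [exact: cvg_fst|exact: Df].
Qed.

Lemma C1_snd (V W : normedModType R) (f : W -> R) : C1 W f ->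
  C1 (V * W)%type (fun p => f p.2).
Proof.
move=> [df Df]; split.
  move=> p; apply: (@differentiable_comp _ _ _ _ snd f); last exact: df.
  by apply: linear_differentiable => q; first [exact: cvg_fst|exact: cvg_snd].
move=> v; rewrite (_ : 'D_v _ = ('D_v.2 f) \o snd)//.
by move=> p; apply: continuous_comp; [exact: cvg_snd|exact: Df].
Qed.

Lemma derive_scale1 (f : R -> R) (x v : R) : derivable f x 1 -> 'D_v f x = v * 'D_1 f x.
Proof.
move=> /derivable1_diffP df; rewrite !deriveE//.
by rewrite -[in LHS](mulr1 v) -[v * 1]/(v *: 1) linearZ.
Qed.

Lemma C1_comp (V : normedModType R) (h : R -> R) (f : V -> R) : C1 R h -> C1 V f ->
  C1 V (fun x => h (f x)).
Proof.
move=> Ch Cf; split; first by move=> x; apply: differentiable_comp;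
  [exact: Cf.1|exact: Ch.1].
move=> v; rewrite (_ : 'D_v _ = fun x => 'D_v f x * 'D_1 h (f x)).
  move=> x; apply: cvgM; first exact: Cf.2.
  by apply: (@continuous_comp _ _ _ f ('D_1 h)); [exact: C1_continuous|exact: Ch.2].
apply/funext => x; rewrite deriveE; last by apply: differentiable_comp;
  [exact: Cf.1|exact: Ch.1].
have -> : 'd (fun x => h (f x)) x = ('d h (f x) \o 'd f x) :> (V -> R).
  exact: (diff_comp (Cf.1 x) (Ch.1 (f x))).
rewrite /= -(deriveE _ (Cf.1 x)) -(deriveE _ (Ch.1 (f x))) (derive_scale1 h (f x)
  ('D_v f x))//.
by apply/derivable1_diffP; exact: Ch.1.
Qed.

Lemma C1_is_derive (f f' : R -> R) : (forall x, is_derive x (1 : R) f (f' x)) ->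
  continuous f' -> C1 R f.
Proof.
move=> df cf'; split; first by move=> x; apply/derivable1_diffP; exact: ex_derive.
move=> v; rewrite (_ : 'D_v f = fun x => v * f' x).
  by move=> x; apply: cvgM; [exact: cvg_cst|exact: cf'].
by apply/funext => x; rewrite (derive_scale1 f x v)// derive_val.
Qed.

Lemma C1_id : C1 R (fun x => x).
Proof. by apply: (@C1_is_derive _ (fun=> 1)) => x; exact: cvg_cst. Qed.

(** An elementary C1 function that vanishes exactly on a half-line; all the test
    functions are built from it. *)
Definition pos_sqr (s : R) : R := Num.max s 0 ^+ 2.

Lemma is_derive_pos_sqr (x : R) : is_derive x (1 : R) pos_sqr (2 * Num.max x 0).
Proof.
have h : (fun h => h^-1 *: ((pos_sqr \o shift x) (h *: (1 : R)) - pos_sqr x)) @ 0^' -->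
   (2 * Num.max x 0 : R).
  apply/cvgrPdist_le => e e0; near=> h.
  have h0 : h != 0 by near: h; exact: nbhs_dnbhs_neq.
  have he : `|h| <= e by near: h; apply: dnbhs0_le.
  apply: le_trans he.
  rewrite -(ler_pM2l (_ : 0 < `|h|)) ?normr_gt0// -normrM -[leRHS]normrM.
  rewrite mulrBr [X in _ - X](_ : _ = pos_sqr (h + x) - pos_sqr x); last first.
    by rewrite /= -[h *: 1]/(h * 1) mulr1 -[_ *: _]/(_ * _) mulrA mulfV// mul1r.
  rewrite [leRHS]ger0_norm; last by rewrite -expr2 sqr_ge0.
  rewrite /pos_sqr.
  (* The error of the linear approximation is at most h ^ 2, uniformly in x. *)
  rewrite ler_norml; case: (ltP (h + x) 0) => a; case: (ltP x 0) => b; apply/andP;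
    split; nra.
split; first by apply/cvg_ex; eexists; exact: h.
exact: (cvg_lim _ h).
Unshelve. all: by end_near.
Qed.

Lemma C1_pos_sqr : C1 R pos_sqr.
Proof.
apply: (C1_is_derive _ _ is_derive_pos_sqr) => x.
apply: cvgM; first exact: cvg_cst.
by apply: continuous_max; [exact: cvg_id|exact: cvg_cst].
Qed.
End C1.

(** * Smooth cutoffs exhausting an open set of the plane *)

Section bumps.
Context {R : realType}.

Lemma pos_sqr_ge0 (s : R) : 0 <= pos_sqr s.
Proof. exact: sqr_ge0. Qed.

Lemma pos_sqr_gt0 (s : R) : 0 < s -> 0 < pos_sqr s.
Proof. by move=> s0; rewrite /pos_sqr exprn_gt0// lt_max s0. Qed.

Lemma pos_sqr_eq0 (s : R) : s <= 0 -> pos_sqr s = 0.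
Proof. by move=> s0; rewrite /pos_sqr max_r// expr0n. Qed.

Lemma C1_affine (a b : R) : C1 R (fun t => a * t + b).
Proof. by apply: C1D; [apply: C1M; [exact: C1_cst|exact: C1_id]|exact: C1_cst]. Qed.

Definition bump (a b t : R) := pos_sqr (t - a) * pos_sqr (b - t).

Lemma C1_bump a b : C1 R (bump a b).
Proof.
apply: C1M; apply: (@C1_comp _ _ pos_sqr); try exact: C1_pos_sqr.
  by apply: C1D; [exact: C1_id|exact: C1_cst].
rewrite (_ : (fun t => b - t) = (fun t => -1 * t + b)); first exact: C1_affine.
by apply/funext => t; rewrite mulN1r addrC.
Qed.

Lemma C1_measurable (f : R -> R) : C1 R f -> measurable_fun setT (f : mline R ->
  mline R).
Proof. by move=> Cf; apply: continuous_measurable_fun; exact: C1_continuous. Qed.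

Definition rect := (rat * rat * rat * rat)%type.
Definition closed_rect (r : rect) : set (R * R) :=
  `[ratr r.1.1.1, ratr r.1.1.2] `*` `[ratr r.1.2, ratr r.2].
Definition rect_bump (r : rect) (p : R * R) : R :=
  bump (ratr r.1.1.1) (ratr r.1.1.2) p.1 * bump (ratr r.1.2) (ratr r.2) p.2.

Lemma rect_bump_ge0 r p : 0 <= rect_bump r p.
Proof. by apply: mulr_ge0; apply: mulr_ge0; exact: pos_sqr_ge0. Qed.

Lemma rect_bump_supp r p : rect_bump r p != 0 -> closed_rect r p.
Proof.
rewrite /rect_bump /bump mulf_eq0 (mulf_eq0 (pos_sqr (p.1 - _))) (mulf_eq0 (pos_sqr
  (p.2 - _))) !negb_or => /andP[/andP[a b] /andP[c d]].
have h (s : R) : pos_sqr s != 0 -> 0 <= s.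
  by apply: contraR; rewrite -ltNge => /ltW/pos_sqr_eq0 ->.
have := h _ a; have := h _ b; have := h _ c; have := h _ d; rewrite !subr_ge0 => *.
by split => /=; rewrite in_itv /=; apply/andP.
Qed.

Variable U : set (R * R).

(** Countably many bumps suffice: the closed rectangles with rational corners that
    lie in [U] cover it by their interiors. *)
Definition inner_bump (i : nat) (p : R * R) : R :=
  if unpickle i is Some r then if `[< closed_rect r `<=` U >] then rect_bump r p else 0
  else 0.

Definition bump_sum n p := \sum_(i < n) inner_bump i p.

Lemma bump_sumS n p : bump_sum n.+1 p = bump_sum n p + inner_bump n p.
Proof. by rewrite /bump_sum big_ord_recr. Qed.

(** Compose with [1 - exp (- n s)] to turn the sum of the first [n] bumps, positive
    on larger and larger parts of [U], into functions that tend to 1 on [U]. *)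
Definition cutoff n p := 1 - expR (- (n%:R * bump_sum n p)).

Lemma inner_bump_ge0 i p : 0 <= inner_bump i p.
Proof. by rewrite /inner_bump; case: (unpickle i : option rect) => // r;
  case: ifP => // _; exact: rect_bump_ge0. Qed.

Lemma bump_sum_ge0 n p : 0 <= bump_sum n p.
Proof. by apply: sumr_ge0 => i _; exact: inner_bump_ge0. Qed.

Lemma cutoff_ge0 n p : 0 <= cutoff n p.
Proof. by rewrite subr_ge0 -expR0 ler_expR oppr_le0 mulr_ge0// bump_sum_ge0. Qed.

Lemma cutoff_le1 n p : cutoff n p <= 1.
Proof. by rewrite gerBl expR_ge0. Qed.

Lemma C1_inner_bump i : C1 (R * R)%type (inner_bump i).
Proof.
rewrite /inner_bump; case: (unpickle i : option rect) => [r|]; last exact: C1_cst.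
case: (asboolP (closed_rect r `<=` U)) => _; last exact: C1_cst.
by apply: C1M; [apply: C1_fst|apply: C1_snd]; exact: C1_bump.
Qed.

Lemma C1_bump_sum n : C1 (R * R)%type (bump_sum n).
Proof.
elim: n => [|n IH].
  by rewrite (_ : bump_sum 0 = fun=> 0); [exact: C1_cst|apply/funext => p;
    rewrite /bump_sum big_ord0].
rewrite (_ : bump_sum n.+1 = fun p => bump_sum n p + inner_bump n p).
  by apply: C1D => //; exact: C1_inner_bump.
by apply/funext => p; exact: bump_sumS.
Qed.

Lemma C1_cutoff n : C1 (R * R)%type (cutoff n).
Proof.
rewrite (_ : cutoff n = fun p => 1 + (-1) * expR ((- n%:R) * bump_sum n p)); last first.
  by apply/funext => p; rewrite /cutoff mulN1r mulNr.
apply: C1D; first exact: C1_cst.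
apply: C1M; first exact: C1_cst.
apply: (@C1_comp _ _ expR).
  by apply: C1_is_derive => x; exact: continuous_expR.
by apply: C1M; [exact: C1_cst|exact: C1_bump_sum].
Qed.

Lemma measurable_cutoff n : measurable_fun setT (cutoff n : mplane R -> R).
Proof.
apply: measurable_funB => //; apply: measurableT_comp; first exact: measurable_expR.
apply: measurableT_comp => //; apply: measurable_funM => //; apply: measurable_sum => i.
rewrite /inner_bump; case: (unpickle i : option rect) => [r|];
  last exact: measurable_cst.
case: (asboolP (closed_rect r `<=` U)) => _; last exact: measurable_cst.
apply: measurable_funM.
  by apply: (measurableT_comp (C1_measurable _ (C1_bump _ _))).
by apply: (measurableT_comp (C1_measurable _ (C1_bump _ _))).
Qed.

Lemma cutoff_supp n : exists K : set (R * R), [/\ compact K, closed K, K `<=` U &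
  forall p, cutoff n p != 0 -> K p].
Proof.
have [K [cK clK KU KS]] : exists K : set (R * R), [/\ compact K, closed K, K `<=` U &
  forall p, bump_sum n p != 0 -> K p].
  elim: n => [|n [K [cK clK KU KS]]].
    exists set0; split => //; [exact: compact0|exact: closed0|].
    by move=> p; rewrite /bump_sum big_ord0 eqxx.
  have [[r [rU rE]]|E0] : (exists r, closed_rect r `<=` U /\ inner_bump n = rect_bump
    r) \/
     inner_bump n = fun=> 0.
    rewrite /inner_bump; case: (unpickle n : option rect) => [r|]; last by right.
    by case: (asboolP (closed_rect r `<=` U)) => h; [left; exists r|right].
    have cr : compact (closed_rect r) by apply: compact_setX; exact: segment_compact.
    have clr : closed (closed_rect r) by apply: compact_closed.
    exists (K `|` closed_rect r); split.
    - exact: compactU.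
    - exact: closedU.
    - by rewrite subUset.
    - move=> p; rewrite bump_sumS rE.
      have [->|/KS Kp _] := eqVneq (bump_sum n p) 0; last by left.
      by rewrite add0r => /rect_bump_supp; right.
  exists K; split => // p; rewrite bump_sumS E0 addr0; exact: KS.
exists K; split => // p h; apply: KS; apply: contra h => /eqP S0.
by rewrite /cutoff S0 mulr0 oppr0 expR0 subrr.
Qed.

Lemma cutoff_out n p : ~ U p -> cutoff n p = 0.
Proof.
have [K [_ _ KU KS]] := cutoff_supp n.
by move=> Up; apply/eqP; apply: contrapT => /negP/KS/KU.
Qed.

Hypothesis oU : open U.

Lemma inner_bump_gt0 p : U p -> exists i, 0 < inner_bump i p.
Proof.
move=> Up; have [e /= e0 eU] : exists2 e : R, 0 < e & ball p e `<=` U.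
  by have /nbhs_ballP[e e0 eU] := open_nbhs_nbhs (conj oU Up); exists e.
have l1 z : z - e < z by lra.
have l2 z : z < z + e by lra.
have [a] := rat_in_itvoo (l1 p.1); have [b] := rat_in_itvoo (l2 p.1).
have [c] := rat_in_itvoo (l1 p.2); have [d] := rat_in_itvoo (l2 p.2).
rewrite !in_itv /= => /andP[d1 d2] /andP[c1 c2] /andP[b1 b2] /andP[a1 a2].
exists (pickle (a, b, c, d)); rewrite /inner_bump pickleK.
rewrite (_ : `[< _ >] = true); last first.
  apply/asboolP => q; rewrite /closed_rect /= !in_itv /= => -[/andP[q1 q2] /andP[q3
    q4]].
  by apply: eU; split; rewrite /ball /= /ball_ ltr_norml; apply/andP; split; lra.
by rewrite /rect_bump /bump /=; apply: mulr_gt0; apply: mulr_gt0; apply: pos_sqr_gt0;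
  lra.
Qed.

Lemma cvg_cutoff p : U p -> cutoff ^~ p @ \oo --> (1 : R).
Proof.
move=> Up; have [i d0] := inner_bump_gt0 _ Up; set d := inner_bump i p in d0.
apply/cvgrPdist_le => e e0; near=> n.
have iN : (i < n)%N by near: n; exact: nbhs_infty_gt.
have nd : - ln e / d <= n%:R by near: n; exact: nbhs_infty_ger.
have Sd : d <= bump_sum n p.
  rewrite /bump_sum (bigD1 (Ordinal iN))//= lerDl sumr_ge0// => j _;
    exact: inner_bump_ge0.
rewrite /cutoff opprB addrCA subrr addr0 ger0_norm ?expR_ge0//.
rewrite -[leRHS]lnK ?posrE// ler_expR lerNl.
move: nd; rewrite ler_pdivrMr// => /le_trans; apply.
by rewrite ler_wpM2l.
Unshelve. all: by end_near.
Qed.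

(** An open set is where one of the cutoffs is at least one half, so it belongs to
    the product of the Borel sigma-algebras. *)
Lemma measurable_open_plane : measurable (U : set (mplane R)).
Proof.
rewrite (_ : U = \bigcup_n [set p : mplane R | 2^-1 <= cutoff n p]).
  apply: bigcupT_measurable => n; rewrite -[X in measurable X]setTI.
  by apply: measurable_fun_le => //; exact: measurable_cutoff.
apply/seteqP; split => p /=.
  move=> Up; have /cvgrPdist_lt/(_ 2^-1 (ltac:(lra))) [n _ /(_ n (leqnn n)) h] :=
    cvg_cutoff _ Up.
  by exists n => //=; move: h; rewrite /= ltr_norml; lra.
move=> [n _ /= h]; apply: contrapT => /(cutoff_out n) E; move: h; rewrite E; lra.
Qed.
End bumps.

(** * Smooth plateaus on the line *)

Section ramp.
Context {R : realType}.
Implicit Types (s t T : R) (n : nat).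

(** Equal to 1 on the negative half-line and to 0 beyond 1. *)
Definition ramp (s : R) : R := pos_sqr (1 - pos_sqr s).
Definition ramp' (s : R) : R := 2 * Num.max (1 - pos_sqr s) 0 * (- (2 * Num.max s 0)).

Lemma is_derive_ramp (s : R) : is_derive s (1 : R) ramp (ramp' s).
Proof.
apply: (@is_derive1_comp _ pos_sqr (fun s => 1 - pos_sqr s)).
  exact: is_derive_pos_sqr.
have H := is_derive_pos_sqr s.
by apply: is_derive_eq; rewrite add0r mul1r.
Qed.

Lemma ramp_le0 s : s <= 0 -> ramp s = 1.
Proof. by move=> s0; rewrite /ramp (pos_sqr_eq0 s)// subr0 /pos_sqr max_l ?expr1n. Qed.

Lemma ramp_ge1 s : 1 <= s -> ramp s = 0.
Proof.
move=> s1; rewrite /ramp [in LHS]pos_sqr_eq0// subr_le0 /pos_sqr max_l; last by lra.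
by rewrite expr_ge1//; lra.
Qed.

Lemma ramp_ge0 s : 0 <= ramp s. Proof. exact: pos_sqr_ge0. Qed.

Lemma ramp_le1 s : ramp s <= 1.
Proof.
rewrite /ramp /pos_sqr expr_le1 ?le_max ?lexx ?orbT// ge_max ler01 andbT.
by rewrite gerBl sqr_ge0.
Qed.

Lemma ramp'_le0 s : s <= 0 -> ramp' s = 0.
Proof. by move=> s0; rewrite /ramp' (max_r s0) mulr0 oppr0 mulr0. Qed.

Lemma ramp'_ge1 s : 1 <= s -> ramp' s = 0.
Proof.
move=> s1; rewrite /ramp' [X in 2 * X * _]max_r ?mulr0 ?mul0r// subr_le0 /pos_sqr
  max_l; last by lra.
by rewrite expr_ge1//; lra.
Qed.

Lemma ramp'_npos s : ramp' s <= 0.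
Proof.
rewrite /ramp' mulrN oppr_le0; apply: mulr_ge0; apply: mulr_ge0 => //.
all: by rewrite le_max lexx orbT.
Qed.

Lemma continuous_ramp' : continuous ramp'.
Proof.
move=> s.
have cm : forall x : R, {for x, continuous (fun x : R => Num.max x 0)}.
  by move=> x; apply: continuous_max; [exact: cvg_id|exact: cvg_cst].
have c1 : continuous (fun x : R => 1 - pos_sqr x).
  by move=> x; apply: cvgB; [exact: cvg_cst|exact: C1_continuous C1_pos_sqr x].
apply: cvgM.
  apply: cvgM; first exact: cvg_cst.
  apply: (@continuous_comp _ _ _ (fun x => 1 - pos_sqr x) (fun x : R => Num.max x 0));
    [exact: c1|exact: cm].
by apply: cvgN; apply: cvgM; [exact: cvg_cst|exact: cm].
Qed.

Lemma C1_ramp : C1 R ramp.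
Proof. exact: C1_is_derive is_derive_ramp continuous_ramp'. Qed.

(** From 0 to 1 on the interval of length [1 / (n + 1)] before 0. *)
Definition rise n (t : R) := ramp (- n.+1%:R * t + 0).
Definition rise' n (t : R) := - n.+1%:R * ramp' (- n.+1%:R * t + 0).
(** From 1 to 0 on the interval of length [1 / (n + 1)] after [T]. *)
Definition fall (T : R) n (t : R) := ramp (n.+1%:R * t + - n.+1%:R * T).

Lemma is_derive_affine (a b x : R) : is_derive x (1 : R) (fun t => a * t + b) a.
Proof.
by apply: is_derive_eq; rewrite addr0 -[_%:A]/(a * 1) mulr1.
Qed.

Lemma is_derive_rise n t : is_derive t (1 : R) (rise n) (rise' n t).
Proof.
rewrite /rise' mulrC; apply: (@is_derive1_comp _ ramp (fun t => - n.+1%:R * t + 0)).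
  exact: is_derive_ramp.
exact: is_derive_affine.
Qed.

Lemma rise'_ge0 n t : 0 <= rise' n t.
Proof. by rewrite /rise' mulNr -mulrN mulr_ge0// oppr_ge0 ramp'_npos. Qed.

Lemma continuous_rise' n : continuous (rise' n).
Proof.
have c : continuous (fun t : R => ramp' (- n.+1%:R * t + 0)).
  move=> t; apply: (@continuous_comp _ _ _ (fun t : R => - n.+1%:R * t + 0) ramp').
    exact: C1_continuous (C1_affine _ _) t.
  exact: continuous_ramp'.
by move=> t; apply: cvgM; [exact: cvg_cst|exact: c].
Qed.

Lemma C1_rise n : C1 R (rise n).
Proof. exact: C1_is_derive (is_derive_rise n) (continuous_rise' n). Qed.

Lemma C1_fall T n : C1 R (fall T n).
Proof. by apply: (@C1_comp _ _ ramp); [exact: C1_ramp|exact: C1_affine]. Qed.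

Lemma rise_ge0 n t : 0 <= t -> rise n t = 1.
Proof. by move=> t0; rewrite /rise ramp_le0// addr0 mulNr oppr_le0 mulr_ge0. Qed.

Lemma rise_le n t : t <= - n.+1%:R^-1 -> rise n t = 0.
Proof.
move=> t0; rewrite /rise ramp_ge1// addr0 mulNr -mulrN -ler_pdivrMl//.
by rewrite mulr1 lerNr.
Qed.

Lemma rise'0 n t : 0 <= t \/ t <= - n.+1%:R^-1 -> rise' n t = 0.
Proof.
move=> [t0|t0]; rewrite /rise' addr0.
  by rewrite ramp'_le0 ?mulr0// mulNr oppr_le0 mulr_ge0.
by rewrite ramp'_ge1 ?mulr0// mulNr -mulrN -ler_pdivrMl// mulr1 lerNr.
Qed.

Lemma integral_rise' n : (\int[leb1 R]_t (rise' n t)%:E = 1)%E.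
Proof.
have n0 : - n.+1%:R^-1 < (0 : R) by rewrite oppr_lt0 invr_gt0.
transitivity (\int[leb1 R]_(t in `[(- n.+1%:R^-1)%R, 0%R]) (rise' n t)%:E)%E.
  rewrite [RHS]integral_mkcond; apply: eq_integral => t _; rewrite patchE.
  case: ifPn => // /negP tN; rewrite rise'0//.
  have [?|t0] := leP 0 t; first by left.
  right; rewrite leNgt; apply/negP => tn; apply: tN.
  by rewrite inE /= in_itv /= (ltW tn) ltW.
rewrite (@continuous_FTC2 _ (rise' n) (rise n))//.
- by rewrite rise_ge0// rise_le// sube0.
- by apply: continuous_subspaceT; exact: continuous_rise'.
- split.
  + by move=> x _; have := is_derive_rise n x => H; exact: ex_derive.
  + by apply: cvg_at_right_filter; exact: C1_continuous (C1_rise n) _.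
  + by apply: cvg_at_left_filter; exact: C1_continuous (C1_rise n) _.
- by move=> x _; rewrite derive1E; have := is_derive_rise n x => H; exact: derive_val.
Qed.

Definition plateau T n t := fall T n t * rise n t.

Lemma C1_plateau T n : C1 R (plateau T n).
Proof. by apply: C1M; [exact: C1_fall|exact: C1_rise]. Qed.

Lemma plateau_ge0 T n t : 0 <= plateau T n t.
Proof. by apply: mulr_ge0; exact: ramp_ge0. Qed.

Lemma plateau_le1 T n t : plateau T n t <= 1.
Proof. by apply: mulr_ile1; (exact: ramp_ge0 || exact: ramp_le1). Qed.

Lemma fall_le T n t : t <= T -> fall T n t = 1.
Proof. by move=> tT; rewrite /fall ramp_le0// mulNr subr_le0 ler_pM2l. Qed.

Lemma fall_ge T n t : T + n.+1%:R^-1 <= t -> fall T n t = 0.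
Proof.
by move=> tT; rewrite /fall ramp_ge1// mulNr -mulrBr -ler_pdivrMl// mulr1 lerBrDl.
Qed.

(** Up to [T] the derivative only sees the rise, which takes place where the
    functions of the constraint set are equal to 1. *)
Lemma plateau_derive T n t : 0 <= T -> t <= T -> 'D_1 (plateau T n) t = rise' n t.
Proof.
move=> T0 tT; have H := is_derive_rise n t.
have F : is_derive t (1 : R) (fall T n) (ramp' (n.+1%:R * t + - n.+1%:R * T) * n.+1%:R).
  apply: (@is_derive1_comp _ ramp (fun t => n.+1%:R * t + - n.+1%:R * T)).
    exact: is_derive_ramp.
  exact: is_derive_affine.
rewrite deriveM; [|exact: ex_derive|exact: ex_derive].
rewrite !derive_val fall_le// ramp'_le0 ?mul0r; last by rewrite mulNr subr_le0 ler_pM2l.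
by rewrite scaler0 addr0 scale1r.
Qed.

Lemma plateau_supp T n t : plateau T n t != 0 -> `[-1, T + 1]%classic t.
Proof.
rewrite /plateau mulf_eq0 negb_or => /andP[f r].
have n1 : n.+1%:R^-1 <= 1 :> R by rewrite invf_le1// ler1n.
move: (@rise_le n t) (@fall_ge T n t) n1; set d : R := n.+1%:R^-1 => hr hf n1.
rewrite /= in_itv /=; apply/andP; split.
  rewrite leNgt; apply/negP => t1; case/eqP: r; apply: hr; lra.
rewrite leNgt; apply/negP => t1; case/eqP: f; apply: hf; lra.
Qed.

Lemma plateau1 T n t : 0 <= t <= T -> plateau T n t = 1.
Proof. by move=> /andP[t0 tT]; rewrite /plateau fall_le// rise_ge0// mulr1. Qed.

Lemma cvg_plateau T t : plateau T ^~ t @ \oo --> (\1_(`[0, T]%classic) t : R).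
Proof.
have [t0T|t0T] := boolP (t \in `[0, T]).
  rewrite indicE mem_set//; apply: cvg_near_cst; apply: nearW => n.
  by apply: plateau1; move: t0T; rewrite in_itv.
rewrite indicE memNset; last exact/negP.
move: t0T; rewrite in_itv /= negb_and -!ltNge => /orP[t0|tT].
  have [N _ NP] := near_infty_natSinv_lt (PosNum (ltac:(rewrite oppr_gt0//) : 0 < - t)).
  apply: cvg_near_cst; exists N => // n /NP /= nt.
  by rewrite /plateau rise_le ?mulr0// lerNr ltW.
have [N _ NP] := near_infty_natSinv_lt (PosNum (ltac:(rewrite subr_gt0//) : 0 < t - T)).
apply: cvg_near_cst; exists N => // n /NP /= nt.
by rewrite /plateau fall_ge ?mul0r// -lerBrDl ltW.
Qed.
End ramp.

(** * The mass of the vertical derivative over a slab *)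

Section tonelli_mul.
Context d1 d2 (T1 : measurableType d1) (T2 : measurableType d2) (R : realType)
  (m1 : {measure set T1 -> \bar R}) (m2 : {sigma_finite_measure set T2 -> \bar R}).
Hypothesis sm1 : sigma_finite setT m1.

Let m1' : set T1 -> \bar R := m1.
HB.instance Definition _ := Measure.on m1'.
HB.instance Definition _ := @Measure_isSigmaFinite.Build _ _ _ m1' sm1.

Lemma tonelli_mul (f : T1 -> R) (g : T2 -> R) :
  measurable_fun setT f -> measurable_fun setT g ->
  (forall x, 0 <= f x) -> (forall t, 0 <= g t) ->
  (\int[m1 \x m2]_p (f p.1 * g p.2)%:E =
   \int[m1]_x ((f x)%:E * \int[m2]_t (g t)%:E))%E.
Proof.
move=> mf mg f0 g0.
transitivity (\int[m1']_x fubini_F m2 (fun p => (f p.1 * g p.2)%:E) x)%E.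
  apply: (@fubini_tonelli1 _ _ _ _ R m1' m2).
    by apply/measurable_EFinP; apply: measurable_funM; exact: measurableT_comp.
  by move=> p; rewrite lee_fin mulr_ge0.
apply: eq_integral => x _; rewrite /fubini_F /=.
under eq_integral do rewrite EFinM.
rewrite ge0_integralZl//; first exact/measurable_EFinP.
- by move=> t _; rewrite lee_fin.
- by rewrite lee_fin.
Qed.
End tonelli_mul.

Section tonelli.
Context (R : realType).

Lemma sigma_finite_leb2 : sigma_finite setT (leb2 R).
Proof.
have /sigma_finiteP[F [TF ndF Foo]] := sigma_finiteT (@lebesgue_measure R).
exists (fun n => F n `*` F n).
  apply/seteqP; split => // -[x y] _.
  have : [set: R] x by []. rewrite TF => -[n _ Fx].
  have : [set: R] y by []. rewrite TF => -[k _ Fy].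
  exists (maxn n k) => //; split => /=.
    exact: (subsetPset _ _ (ndF _ _ (leq_maxl n k))).
  exact: (subsetPset _ _ (ndF _ _ (leq_maxr n k))).
move=> n; have [mF Fn] := Foo n; split; first exact: measurableX.
by rewrite product_measure1E// lte_mul_pinfty// ge0_fin_numE.
Qed.

Lemma tonelli_leb3 (f : mplane R -> R) (g : R -> R) :
  measurable_fun setT f -> measurable_fun setT (g : mline R -> mline R) ->
  (forall x, 0 <= f x) -> (forall t, 0 <= g t) ->
  (\int[leb3 R]_p (f p.1 * g p.2)%:E =
   \int[leb2 R]_x ((f x)%:E * \int[leb1 R]_t (g t)%:E))%E.
Proof.
move=> mf mg f0 g0.
exact: (@tonelli_mul _ _ _ _ R (leb2 R) (leb1 R) sigma_finite_leb2 f g mf mg f0 g0).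
Qed.
End tonelli.

Lemma cvg_integral_indic d (T : measurableType d) (R : realType)
  (m : {measure set T -> \bar R}) (A B : set T) (F : nat -> T -> R) :
  measurable A -> measurable B -> (m B < +oo)%E -> (forall n, measurable_fun setT (F
    n)) ->
  (forall n x, 0 <= F n x <= \1_B x) ->
  (forall x, F ^~ x @ \oo --> (\1_A x : R)) ->
  (fun n => \int[m]_x (F n x)%:E)%E @ \oo --> m A.
Proof.
move=> mA mB mBoo mF F01 FA.
rewrite -(setIT A) -integral_indic//.
have iB : m.-integrable setT (EFin \o \1_B).
  apply/integrableP; split; first by apply/measurable_EFinP; exact: measurable_indic.
  under eq_integral do rewrite gee0_abs ?lee_fin//.
  by rewrite integral_indic// setIT.
have [] := @dominated_convergence _ _ _ m setT measurableT
  (fun n x => (F n x)%:E) (EFin \o \1_A) (EFin \o \1_B).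
- by move=> n; exact/measurable_EFinP.
- by apply/measurable_EFinP; exact: measurable_indic.
- by apply: aeW => x _; apply: cvg_EFin; [exact: nearW|exact: FA].
- exact: iB.
- apply: aeW => x n _ /=; have /andP[F0 F1] := F01 n x.
  by rewrite lee_fin ger0_norm.
by [].
Qed.

Section mass.
Context (R : realType) (Om : image_domain R) (phi : R * R -> R -> R).
Variable (m : {finite_measure set (mspace R) -> \bar R}).
Hypothesis phiP : Cpp Om phi.
Hypothesis mP : is_opp_Dgamma Om phi m.
Variable (T : R).
Hypothesis T1 : 1 <= T.

Let U := (dom Om)°.
Let oU : open U. Proof. exact: open_interior. Qed.
Let mU : measurable (U : set (mplane R)). Proof. exact: measurable_open_plane. Qed.
Let T0 : 0 <= T. Proof. exact: le_trans T1. Qed.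

Definition slab_test n (p : R * R * R) : R := cutoff U n p.1 * plateau T n p.2.

Lemma slab_test_C1c n : C1c (U `*` setT) (slab_test n).
Proof.
have [df Df] : C1 (R * R * R)%type (slab_test n).
  apply: C1M; first exact: C1_fst (C1_cutoff U n).
  exact: C1_snd (C1_plateau T n).
have [K [cK clK KU KS]] := cutoff_supp U n.
have sub : closure [set x | slab_test n x != 0] `<=` K `*` `[-1, T + 1].
  rewrite (closure_id (K `*` `[-1, T + 1])).1; last first.
    apply: compact_closed; first exact: norm_hausdorff.
    by apply: compact_setX => //; exact: segment_compact.
  apply: closure_subset => p /=;
    rewrite /slab_test mulf_eq0 negb_or => /andP[/KS Kp /plateau_supp].
  by [].
split => //.
- apply: (subclosed_compact _ _ sub); first exact: closed_closure.
  by apply: compact_setX => //; exact: segment_compact.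
- by apply: subset_trans sub _ => p [Kp _]; split => //; exact: KU.
Qed.

Lemma slab_test_derive n p : p.2 <= T ->
  'D_(0, 0, 1) (slab_test n) p = cutoff U n p.1 * rise' n p.2.
Proof.
move=> pT.
have C1a : C1 (R * R * R)%type (fun p : R * R * R => cutoff U n p.1) by exact: C1_fst
  (C1_cutoff U n).
have C1b : C1 (R * R * R)%type (fun p : R * R * R => plateau T n p.2) by exact:
  C1_snd (C1_plateau T n).
rewrite [LHS](deriveM (C1_derivable _ _ p (0, 0, 1) C1a) (C1_derivable _ _ p (0, 0,
  1) C1b)).
have -> : 'D_(0, 0, 1) (fun p : R * R * R => cutoff U n p.1) p = 'D_0 (cutoff U n)
  p.1 by [].
have -> : 'D_(0, 0, 1) (fun p : R * R * R => plateau T n p.2) p = 'D_1 (plateau T n)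
  p.2 by [].
have -> : 'D_0 (cutoff U n) p.1 = 0.
  by rewrite (deriveE _ ((C1_cutoff U n).1 p.1)) linear0.
by rewrite plateau_derive// scaler0 addr0.
Qed.

(** Test the definition of [D_gamma phi].  The vertical derivative of the test
    function is supported where [phi] is 1 (before 0), where it is zero
    (between 0 and [T]), and where [phi] is 0 (beyond [T >= 1]): the unknown
    values of [phi] are never seen, and the integral factors. *)
Lemma integral_slab_test n :
  (\int[m]_p (slab_test n p)%:E = \int[leb2 R]_x (cutoff U n x)%:E)%E.
Proof.
rewrite -(mP.2 _ (slab_test_C1c n)).
have [_ _ phi1 phi0 _] := phiP.
transitivity (\int[leb3 R]_p ((cutoff U n p.1 * rise' n p.2)%:E))%E.
  rewrite integral_mkcond; apply: eq_integral => p _; rewrite patchE;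
    case: ifPn => [|/negP pO]; last first.
    rewrite cutoff_out//; first by rewrite mul0r.
    by move=> /interior_subset ?; apply: pO; rewrite inE.
  rewrite inE => -[/= Op _]; congr EFin.
  have [p0|p0] := leP p.2 0.
    by rewrite phi1// mul1r slab_test_derive// (le_trans p0).
  have r0 : rise' n p.2 = 0 by rewrite rise'0//; left; exact: ltW.
  have [pT|pT] := leP p.2 T; first by rewrite slab_test_derive// r0 !mulr0.
  by rewrite phi0// ?mul0r ?r0 ?mulr0// (le_trans T1)// ltW.
rewrite (@tonelli_leb3 R (cutoff U n) (rise' n)).
- by apply: eq_integral => x _; rewrite integral_rise' mule1.
- exact: measurable_cutoff.
- by apply: continuous_measurable_fun; exact: continuous_rise'.
- by move=> x; exact: cutoff_ge0.
- by move=> t; exact: rise'_ge0.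
Qed.

Lemma leb2_interior : leb2 R U = leb2 R Om.
Proof.
have mO := dom_meas Om.
rewrite -[in RHS](setDUK (interior_subset (A := dom Om))) measureU//; last 2 first.
- exact: measurableD.
- by rewrite setDIK.
by rewrite [X in (_ + X)%E](_ : _ = 0%E) ?adde0//; exact: dom_bd.
Qed.

Lemma cvg_cutoff_indic x : cutoff U ^~ x @ \oo --> (\1_U x : R).
Proof.
rewrite indicE; have [Ux|nUx] := pselect (U x).
  by rewrite mem_set//; exact: cvg_cutoff.
by rewrite memNset//; apply: cvg_near_cst; apply: nearW => n; exact: cutoff_out.
Qed.

Lemma cvg_integral_cutoff :
  (fun n => \int[leb2 R]_x (cutoff U n x)%:E)%E @ \oo --> leb2 R U.
Proof.
apply: (@cvg_integral_indic _ _ _ (leb2 R) U U (cutoff U) mU mU).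
- by have := dom_lty Om; rewrite -leb2_interior.
- by move=> n; exact: measurable_cutoff.
- move=> n x; rewrite cutoff_ge0 indicE /=.
  have [Ux|nUx] := pselect (U x); first by rewrite mem_set// cutoff_le1.
  by rewrite cutoff_out.
- exact: cvg_cutoff_indic.
Qed.

Lemma cvg_integral_slab_test :
  (fun n => \int[m]_p (slab_test n p)%:E)%E @ \oo --> m (U `*` `[0, T]).
Proof.
have mUT : measurable (U `*` `[0, T] : set (mspace R)) by exact: measurableX.
apply: (@cvg_integral_indic _ _ _ m _ setT slab_test mUT measurableT).
- by rewrite ltey_eq fin_num_measure.
- move=> n; apply: measurable_funM.
    exact: (measurableT_comp (@measurable_cutoff R U n)).
  apply: measurableT_comp => //; exact: C1_measurable (C1_plateau T n).
- move=> n p; rewrite indicE in_setT; apply/andP; split.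
    by apply: mulr_ge0; rewrite ?cutoff_ge0 ?plateau_ge0.
  by apply: mulr_ile1; rewrite ?cutoff_ge0 ?cutoff_le1 ?plateau_ge0 ?plateau_le1.
- move=> p; rewrite [X in _ --> X](_ : _ = \1_U p.1 * \1_(`[0, T]%classic) p.2 :> R);
  last first.
    by rewrite !indicE in_setX -mulnb natrM.
  by apply: cvgM; [exact: cvg_cutoff_indic|exact: cvg_plateau].
Qed.

(** The test functions tend to the indicator of the interior of
    Omega times [0, T], and their
    integrals to the measure of [Omega], whose boundary part is negligible.  So
    all the mass sits over [0, 1], and [mu_phi] is a probability. *)
Lemma opp_Dgamma_slab : m (Om `*` `[0, T]) = leb2 R Om.
Proof.
have mO := dom_meas Om.
have mUT : measurable (U `*` `[0, T] : set (mspace R)) by exact: measurableX.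
have mOT : measurable (Om `*` `[0, T] : set (mspace R)) by exact: measurableX.
have mUR : measurable (U `*` setT : set (mspace R)) by exact: measurableX.
transitivity (m (U `*` `[0, T])).
  apply/eqP; rewrite eq_le; apply/andP; split.
    apply: (@le_trans _ _ (m ((U `*` `[0, T]) `|` ~` (U `*` setT)))).
      apply: le_measure; rewrite ?inE//.
        by apply: measurableU => //; exact: measurableC.
      move=> p [/= Op pT]; have [Up|nUp] := pselect (U p.1); [by left|right].
      by move=> [/nUp].
    apply: le_trans (measureU2 _ _ _) _ => //; first exact: measurableC.
    by rewrite [X in (_ + X)%E](_ : _ = 0%E) ?adde0//; exact: mP.1.
  by apply: le_measure; rewrite ?inE// => p [/interior_subset ? ?].
rewrite -leb2_interior; apply: (cvg_unique _ cvg_integral_slab_test) => //.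
rewrite (_ : (fun n => _) = fun n => \int[leb2 R]_x (cutoff U n x)%:E)%E.
  exact: cvg_integral_cutoff.
by apply/funext => n; exact: integral_slab_test.
Qed.
End mass.

(** * Weak duality from the Hoeffding-Frechet bounds *)

Lemma eq_measure_rays (R : realType) (m1 m2 : {measure set (mline R) -> \bar R}) :
  (m1 setT < +oo)%E ->
  (forall t : R, m1 `]-oo, t]%classic = m2 `]-oo, t]%classic) ->
  forall A, measurable A -> m1 A = m2 A.
Proof.
move=> m1oo m12.
have fin1 (A : set (mline R)) : measurable A -> (m1 A < +oo)%E.
  by move=> mA; apply: le_lt_trans m1oo; apply: le_measure; rewrite ?inE.
have fin2 t : (m2 `]-oo, t]%classic < +oo)%E by rewrite -m12; exact: fin1.
apply: (@measure_unique _ R (mline R) (@ocitv R) (fun n : nat => `](- n%:R)%R,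
  n%:R]%classic)) => //.
- exact: ocitvI.
- by move=> n; exact: is_ocitv.
- apply/seteqP; split => // x _.
  have [n _ /(_ n (leqnn n)) nx] := @nbhs_infty_gtr R `|x|.
  exists n => //=; rewrite in_itv /=.
  by move: nx => /=; rewrite ltr_norml => /andP[? /ltW ->]; rewrite andbT.
- move=> _ [[a b] _ <-] /=.
  have [ab|ba] := leP a b; last by rewrite set_itv_ge ?measure0// bnd_simp -leNgt ltW.
  have -> : `]a, b]%classic = `]-oo, b]%classic `\` `]-oo, a]%classic :> set R.
    by rewrite -[RHS]setCK setCD setCitvl setUC -[LHS]setCK setCitv.
  rewrite !measureD//; first [exact: fin1|exact: fin2|idtac].
  have sab : `]-oo, a]%classic `<=` (`]-oo, b]%classic : set R) by exact: subset_itvl.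
  rewrite (setIidr sab).
  by congr (_ - _)%E; exact: m12.
- by move=> n; exact: fin1.
Qed.

Lemma eq_marginal (R : realType) (dF : probability (mplane R) R) (pr : mplane R ->
  mline R)
  (m : {measure set (mline R) -> \bar R}) :
  measurable_fun setT pr ->
  (forall t, dF (pr @^-1` `]-oo, t]%classic) = m (`]-oo, t]%classic `&` `[0%R,
    1%R]%classic)) ->
  forall A, measurable A -> dF (pr @^-1` A) = m (A `&` `[0%R, 1%R]%classic).
Proof.
move=> mpr H A mA.
pose prm : {mfun mplane R >-> mline R} := HB.pack pr (isMeasurableFun.Build _ _ _ _ _
  mpr).
have := @eq_measure_rays R (distribution dF prm) (mrestr m (measurable_itv `[0%R,
  1%R])).
apply => //.
exact: (le_lt_trans (probability_le1 (distribution dF prm) measurableT) (ltry 1)).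
Qed.

Section marginal_integral.
Context (R : realType) (dF : probability (mplane R) R) (pr : mplane R -> mline R).
Local Notation I01 := (`[0%R, 1%R]%classic : set (mline R)).
Variables (m : {measure set (mline R) -> \bar R}) (psi : R -> R).
Hypothesis mpr : measurable_fun setT pr.
Hypothesis marg : forall A, measurable A -> dF (pr @^-1` A) = m (A `&` I01).
Hypothesis ipsi : m.-integrable I01 (EFin \o psi).

Let prm : {mfun mplane R >-> mline R} := HB.pack pr (isMeasurableFun.Build _ _ _ _ _
  mpr).

Let mpsi : measurable_fun setT (psi \_ I01 : mline R -> mline R).
Proof.
apply/measurable_EFinP; rewrite -restrict_EFin.
apply/(measurable_restrictT _ _).1 => //; by case/integrableP : ipsi.
Qed.

Let push_eq (h : mline R -> \bar R) :
  (\int[distribution dF prm]_(x in I01) h x = \int[m]_(x in I01) h x)%E.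
Proof.
apply: eq_measure_integral => A mA AI; rewrite -[X in _ = m X](setIidl AI).
exact: marg.
Qed.

Let restrictE x : I01 x -> (psi \_ I01) x = psi x.
Proof. by move=> xI; rewrite patchE mem_set. Qed.

Let mEpsi : measurable_fun setT (EFin \o (psi \_ I01) : mline R -> \bar R).
Proof. exact/measurable_EFinP. Qed.

Let integrable_restrict :
  dF.-integrable (pr @^-1` I01) ((EFin \o (psi \_ I01)) \o pr).
Proof.
apply/integrableP; split.
  by apply: measurable_funTS; exact: measurableT_comp.
rewrite -(@ge0_integral_pushforward _ _ _ _ _ pr mpr dF I01 (abse \o (EFin \o (psi \_
  I01))))//; last first.
- by move=> x _ /=; rewrite lee_fin.
- by apply: measurable_funTS; exact: measurableT_comp.
rewrite [X in (X < _)%E](_ : _ = \int[m]_(x in I01) `|(psi x)%:E|)%E.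
  by case/integrableP : ipsi.
transitivity (\int[m]_(x in I01) `|((psi \_ I01) x)%:E|)%E; first exact: push_eq.
by apply: eq_integral => x; rewrite inE => xI; rewrite restrictE.
Qed.

Lemma marginal_integrable : dF.-integrable (pr @^-1` I01) (fun p => (psi (pr p))%:E).
Proof.
apply: eq_integrable integrable_restrict => //.
  by rewrite -[X in measurable X]setTI; exact: mpr.
by move=> p; rewrite inE => pI /=; rewrite restrictE.
Qed.

Lemma marginal_integral :
  (\int[dF]_(p in pr @^-1` I01) (psi (pr p))%:E = \int[m]_(x in I01) (psi x)%:E)%E.
Proof.
transitivity (\int[dF]_(p in pr @^-1` I01) ((EFin \o (psi \_ I01)) \o pr) p)%E.
  by apply: eq_integral => p; rewrite inE => pI /=; rewrite restrictE.
rewrite -(integral_pushforward mpr mEpsi integrable_restrict)//.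
transitivity (\int[m]_(x in I01) ((psi \_ I01) x)%:E)%E; first exact: push_eq.
by apply: eq_integral => x; rewrite inE => xI; rewrite restrictE.
Qed.

End marginal_integral.

Section weak_duality.
Context (R : realType) (mu nu : {measure set (mline R) -> \bar R}).
Local Notation I01 := (`[0%R, 1%R]%classic : set (mline R)).
Hypothesis mu1 : mu I01 = 1%E.
Hypothesis nu1 : nu I01 = 1%E.
Variable dF : probability (mplane R) R.

Definition cdf01 (m : set (mline R) -> \bar R) (t : R) := m (I01 `&` `]-oo, t]%classic).

Definition frechet_bounds := forall g1 g2 : R,
  (cdf01 mu g1 + cdf01 nu g2 - 1 <= dF (`]-oo, g1] `*` `]-oo, g2])
    <= mine (cdf01 mu g1) (cdf01 nu g2))%E.

Hypothesis bounds : frechet_bounds.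

Let cdf1 (m : {measure set (mline R) -> \bar R}) : m I01 = 1%E -> cdf01 m 1 = 1%E.
Proof.
by move=> <-; rewrite /cdf01 setIidl// => x /=; rewrite !in_itv /= => /andP[].
Qed.

Let mrect (g1 g2 : R) : measurable (`]-oo, g1] `*` `]-oo, g2] : set (mplane R)).
Proof. exact: measurableX. Qed.

Let dF0 : dF (~` (`]-oo, 1%R] `*` `]-oo, 1%R])) = 0%E.
Proof.
rewrite probability_setC//.
suff -> : dF (`]-oo, 1%R] `*` `]-oo, 1%R]) = 1%E by rewrite subee.
apply/eqP; rewrite eq_le probability_le1//=.
have /andP[+ _] := bounds 1 1; apply: le_trans.
by rewrite (cdf1 _ mu1) (cdf1 _ nu1) addeK.
Qed.

Let marginal_fst A : measurable A -> dF (fst @^-1` A) = mu (A `&` I01).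
Proof.
move=> mA; apply: eq_marginal => // t.
have mt : measurable (fst @^-1` `]-oo, t]%classic : set (mplane R)).
  by rewrite -[X in measurable X]setTI; exact: measurable_fst.
rewrite setIC -/(cdf01 mu t); apply/eqP; rewrite eq_le; apply/andP; split.
  apply: (@le_trans _ _ (dF (`]-oo, t] `*` `]-oo, 1%R]))); last first.
    by have /andP[_] := bounds t 1; rewrite le_min => /andP[].
  apply: (@le_trans _ _ (dF ((`]-oo, t] `*` `]-oo, 1%R]) `|` ~` (`]-oo, 1%R] `*`
    `]-oo, 1%R])))).
    apply: le_measure; rewrite ?inE//.
      by apply: measurableU => //; exact: measurableC.
    move=> p pt; have [p2|p2] := pselect (`]-oo, 1%R]%classic p.2); first by left.
    by right => -[].
  apply: le_trans (measureU2 _ _ _) _ => //; first exact: measurableC.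
  by rewrite [X in (_ + X)%E](_ : _ = 0%E) ?adde0.
apply: (@le_trans _ _ (dF (`]-oo, t] `*` `]-oo, 1%R]))).
  by have /andP[+ _] := bounds t 1; rewrite (cdf1 _ nu1) addeK.
by apply: le_measure; rewrite ?inE// => p [].
Qed.

Let marginal_snd A : measurable A -> dF (snd @^-1` A) = nu (A `&` I01).
Proof.
move=> mA; apply: eq_marginal => // t.
have mt : measurable (snd @^-1` `]-oo, t]%classic : set (mplane R)).
  by rewrite -[X in measurable X]setTI; exact: measurable_snd.
rewrite setIC -/(cdf01 nu t); apply/eqP; rewrite eq_le; apply/andP; split.
  apply: (@le_trans _ _ (dF (`]-oo, 1%R] `*` `]-oo, t]))); last first.
    by have /andP[_] := bounds 1 t; rewrite le_min => /andP[].
  apply: (@le_trans _ _ (dF ((`]-oo, 1%R] `*` `]-oo, t]) `|` ~` (`]-oo, 1%R] `*`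
    `]-oo, 1%R])))).
    apply: le_measure; rewrite ?inE//.
      by apply: measurableU => //; exact: measurableC.
    move=> p pt; have [p2|p2] := pselect (`]-oo, 1%R]%classic p.1); first by left.
    by right => -[].
  apply: le_trans (measureU2 _ _ _) _ => //; first exact: measurableC.
  by rewrite [X in (_ + X)%E](_ : _ = 0%E) ?adde0.
apply: (@le_trans _ _ (dF (`]-oo, 1%R] `*` `]-oo, t]))).
  by have /andP[+ _] := bounds 1 t; rewrite (cdf1 _ mu1) [(1 + _)%E]addeC addeK.
by apply: le_measure; rewrite ?inE// => p [].
Qed.

Variables (c : R -> R -> R) (M : R).
Hypothesis mc : measurable_fun (I01 `*` I01) (fun p : mplane R => c p.1 p.2).
Hypothesis cM : forall p, (I01 `*` I01) p -> - M <= c p.1 p.2.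

(** At [g2 = 1] the lower and the upper bound on [F (g1, g2)] agree, since the second
    marginal has all its mass on [0, 1]; hence the bounds determine the
    marginals of [dF], and the dual inequality can be integrated.  The cost may
    have an infinite integral, in which case there is nothing to prove. *)
Lemma weak_duality (u v : R -> R) :
  mu.-integrable I01 (EFin \o u) -> nu.-integrable I01 (EFin \o v) ->
  (forall p, (I01 `*` I01) p -> u p.1 - v p.2 <= c p.1 p.2) ->
  (\int[mu]_(x in I01) (u x)%:E - \int[nu]_(x in I01) (v x)%:E <=
   \int[dF]_(p in I01 `*` I01) (c p.1 p.2)%:E)%E.
Proof.
move=> iu iv uvc.
have msq : measurable (I01 `*` I01 : set (mplane R)) by exact: measurableX.
have mf1 : measurable (fst @^-1` I01 : set (mplane R)) by rewrite -[X in measurable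
  X]setTI; exact: measurable_fst.
have mf2 : measurable (snd @^-1` I01 : set (mplane R)) by rewrite -[X in measurable
  X]setTI; exact: measurable_snd.
have N1 : dF (fst @^-1` (~` I01)) = 0%E by rewrite marginal_fst ?setICl//;
  exact: measurableC.
have N2 : dF (snd @^-1` (~` I01)) = 0%E by rewrite marginal_snd ?setICl//;
  exact: measurableC.
have iu' := marginal_integrable _ _ _ _ _ (@measurable_fst _ _ _ _) marginal_fst iu.
have iv' := marginal_integrable _ _ _ _ _ (@measurable_snd _ _ _ _) marginal_snd iv.
rewrite -(marginal_integral _ _ _ _ _ (@measurable_fst _ _ _ _) marginal_fst iu).
rewrite -(marginal_integral _ _ _ _ _ (@measurable_snd _ _ _ _) marginal_snd iv).
rewrite (negligible_integral _ mf1 iu' N2); last by rewrite -[X in measurable X]setTI;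
  apply: measurable_snd => //; exact: measurableC.
rewrite (negligible_integral _ mf2 iv' N1); last by rewrite -[X in measurable X]setTI;
  apply: measurable_fst => //; exact: measurableC.
have -> : fst @^-1` I01 `\` snd @^-1` (~` I01) = I01 `*` I01 :> set (mplane R).
  by apply/seteqP; split => p /= [p1 p2]; split => //; exact: contrapT.
have -> : snd @^-1` I01 `\` fst @^-1` (~` I01) = I01 `*` I01 :> set (mplane R).
  by apply/seteqP; split => p /= [p1 p2]; split => //; exact: contrapT.
have ju : dF.-integrable (I01 `*` I01) (fun p : mplane R => (u p.1)%:E).
  by apply: integrableS iu' => // p [].
have jv : dF.-integrable (I01 `*` I01) (fun p : mplane R => (v p.2)%:E).
  by apply: integrableS iv' => // p [].
rewrite -integralB//.
(* The cost is bounded below, so it is integrable unless its integral is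
   infinite. *)
have [ic|nic] := pselect (dF.-integrable (I01 `*` I01) (fun p : mplane R => (c p.1
  p.2)%:E)).
  apply: le_integral => //; first exact: integrableB.
  by move=> p; rewrite inE => sp; rewrite -EFinB lee_fin uvc.
suff -> : (\int[dF]_(p in I01 `*` I01) (c p.1 p.2)%:E = +oo)%E by rewrite leey.
pose f (p : mplane R) := (c p.1 p.2)%:E.
have mf : measurable_fun (I01 `*` I01) f by exact/measurable_EFinP.
have mfp : measurable_fun (I01 `*` I01) (f^\+)%E by exact: measurable_funepos.
have mfn : measurable_fun (I01 `*` I01) (f^\-)%E by exact: measurable_funeneg.
have fn_lty : (\int[dF]_(p in I01 `*` I01) f^\- p < +oo)%E.
  apply: (@le_lt_trans _ _ (\int[dF]_(p in I01 `*` I01) `|M|%:E)%E); last first.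
    have /integrable_lty : dF.-integrable (I01 `*` I01) (EFin \o cst `|M|).
      exact: finite_measure_integrable_cst.
    by apply.
  apply: ge0_le_integral => //.
  move=> p sp; rewrite funenegE ge_max /f -EFinN !lee_fin normr_ge0 andbT.
  by have := cM _ sp; have := ler_norm M; lra.
have fp_y : (\int[dF]_(p in I01 `*` I01) f^\+ p = +oo)%E.
  apply: contrapT => /eqP; rewrite -ltey => fp_lty; apply: nic.
  apply/integrableP; split => //; 
  rewrite [X in (X < _)%E](_ : _ = \int[dF]_(p in I01 `*` I01) (f^\+ p + f^\- p))%E;
    last first.
    by apply: eq_integral => p _; rewrite -[LHS]/((abse \o f) p) fune_abse.
  by rewrite ge0_integralD//; exact: lte_add_pinfty.
by rewrite integralE -/f fp_y addye// -ltNye lteNr.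
Qed.
End weak_duality.

(** * Distribution functions of the two marginals *)

(** The lower bound is the inclusion-exclusion inequality for the events
    [x <= g1] and [y <= g2]. *)
Lemma frechet_of_marginals (R : realType) (mu nu : {measure set (mline R) -> \bar R})
  (pi : probability (mplane R) R) :
  (forall t, pi [set p | p.1 <= t] = mu (`[0, 1]%classic `&` [set x | x <= t])) ->
  (forall t, pi [set p | p.2 <= t] = nu (`[0, 1]%classic `&` [set x | x <= t])) ->
  frechet_bounds R mu nu pi.
Proof.
move=> pi1 pi2 g1 g2.
have E1 : cdf01 R mu g1 = pi [set p | p.1 <= g1].
  by rewrite pi1 /cdf01; congr (mu (_ `&` _)); apply/seteqP; split => x /=;
    rewrite in_itv.
have E2 : cdf01 R nu g2 = pi [set p | p.2 <= g2].
  by rewrite pi2 /cdf01; congr (nu (_ `&` _)); apply/seteqP; split => x /=;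
    rewrite in_itv.
pose A := [set p : mplane R | p.1 <= g1]; pose B := [set p : mplane R | p.2 <= g2].
have mA : measurable A by rewrite -[X in measurable X]setTI; apply: measurable_fun_le.
have mB : measurable B by rewrite -[X in measurable X]setTI; apply: measurable_fun_le.
rewrite E1 E2 -/A -/B (_ : `]-oo, g1] `*` `]-oo, g2] = A `&` B); last first.
  by apply/seteqP; split => p /= []; rewrite /A /B /= !in_itv.
apply/andP; split; last first.
  by rewrite le_min; apply/andP; split; apply: le_measure; rewrite ?inE//;
    try exact: measurableI;
    move=> p [].
have AE : (pi A = pi (A `&` B) + pi (A `\` B))%E.
  rewrite -measureU//; [by rewrite setUIDK| exact: measurableI|exact: measurableD|].
  by rewrite setDE setIACA setICr setI0.
rewrite leeBlDr// AE -addeA leeD2l// -measureU//;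
  [|exact: measurableD|by rewrite setDE -setIA setICl setI0].
by apply: probability_le1; apply: measurableU => //; exact: measurableD.
Qed.

Lemma lsc_squareP (R : realType) (c : R -> R -> R) :
  lower_semicontinuous
    ((fun p => (c p.1 p.2)%:E) : subspace (`[0, 1] `*` `[0, 1] : set (R * R)) -> \bar
      R) ->
  lsc_square c.
Proof.
move=> lsc p r sp rc.
have sp' : (`[0, 1] `*` `[0, 1] : set (R * R)) p.
  by move: sp => [p1 p2]; split; rewrite /= in_itv.
have [V pV Vr] := lsc p r (ltac:(by rewrite lte_fin)).
have : within (`[0, 1] `*` `[0, 1]) (nbhs p) V by rewrite (nbhs_subspace_in sp').
move=> /nbhs_ballP[e /= e0 eV].
exists e => // p' [s1 s2] h1 h2.
rewrite -lte_fin; apply: Vr; apply: eV; last by split; rewrite /= in_itv.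
by split; rewrite /ball /= distrC.
Qed.

Section mass_of_mu_phi.
Context (R : realType) (Om : image_domain R) (phi : R * R -> R -> R).
Hypothesis phiP : Cpp Om phi.
Local Notation I01 := (`[0%R, 1%R]%classic : set (mline R)).

Lemma opp_DgammaP : is_opp_Dgamma Om phi (opp_Dgamma Om phi).
Proof.
rewrite /opp_Dgamma; case: pselect => [ex|]; first exact: projT2 (cid ex).
by case: phiP.
Qed.

Lemma F_phi_ge1 T : 1 <= T -> F_phi Om phi T = 1%E.
Proof.
move=> T1; rewrite /F_phi [X in (_ * X)%E](_ : _ = leb2 R Om); last first.
  exact: (opp_Dgamma_slab _ _ _ _ phiP opp_DgammaP _ T1).
have Of : leb2 R Om \is a fin_num by rewrite ge0_fin_numE ?dom_lty ?measure_ge0.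
rewrite -[X in (_ * X)%E](fineK Of) -EFinM mulVf// gt_eqF// fine_gt0// dom_gt0 /=.
exact: dom_lty.
Qed.

Lemma mu_phi_cdf t : cdf01 R (mu_phi Om phi) t = F_phi Om phi (Num.min t 1).
Proof.
rewrite /cdf01 /= /mu_phi /F_phi; congr (_ * _)%E; congr (opp_Dgamma Om phi (_ `*` _)).
apply/seteqP; split => x /=; rewrite !in_itv /= le_min.
  by move=> [[/andP[-> ->] ->]].
by move=> /andP[-> /andP[-> ->]].
Qed.

Lemma mu_phi1 : mu_phi Om phi I01 = 1%E.
Proof.
rewrite -(F_phi_ge1 _ (lexx 1)) /mu_phi /F_phi; congr (_ * _)%E.
by rewrite setIid.
Qed.

(** [F_phi] counts all of [0, g] and [mu_phi] only its part in [0, 1]; they agree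
    beyond 1 because there is no mass there. *)
Lemma F_phi_cdf t : F_phi Om phi t = cdf01 R (mu_phi Om phi) t.
Proof.
rewrite mu_phi_cdf; have [//|t1] := leP t 1.
by rewrite !F_phi_ge1// ltW.
Qed.
End mass_of_mu_phi.

Lemma F_mu0_cdf (R : realType) (mu0 : probability (mline R) R) t :
  mu0 `[0%R, 1%R]%classic = 1%E -> F_mu0 mu0 t = cdf01 R mu0 t.
Proof.
move=> m1; rewrite /F_mu0 /cdf01.
have [t1|t1] := leP t 1.
  congr (mu0 _); apply/seteqP; split => x /=; rewrite !in_itv /=.
    by move=> /andP[-> xt]; rewrite xt (le_trans xt).
  by move=> [/andP[-> _] ->].
rewrite (_ : _ `&` _ = `[0, 1]%classic); last first.
  apply/seteqP; split => x /=; rewrite !in_itv /=; first by case.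
  by move=> /andP[-> x1]; rewrite x1 (le_trans x1)// ltW.
transitivity (1%E : \bar R); last by rewrite m1.
apply/eqP; rewrite eq_le probability_le1//= -m1.
apply: le_measure; rewrite ?inE// => x /=; rewrite !in_itv /= => /andP[-> x1].
by rewrite (le_trans x1)// ltW.
Qed.

(** * Equality of the two optimal values *)

Section kantorovich.
Context (R : realType) (Om : image_domain R) (phi : R * R -> R -> R)
  (mu0 : probability (mline R) R).
Hypothesis phiP : Cpp Om phi.
Hypothesis mu0_01 : mu0 `[0%R, 1%R]%classic = 1%E.

Definition admissible (F : R -> R -> R) (dF : probability (mplane R) R) :=
  is_cdf2 dF F /\
  forall g1 g2, (F_phi Om phi g1 + F_mu0 mu0 g2 - 1 <= (F g1 g2)%:E
     <= mine (F_phi Om phi g1) (F_mu0 mu0 g2))%E.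

Lemma admissible_bounds F dF : admissible F dF -> frechet_bounds R (mu_phi Om phi)
  mu0 dF.
Proof.
move=> [cdf bd] g1 g2; have := bd g1 g2.
by rewrite (F_phi_cdf _ _ _ phiP) (F_mu0_cdf _ _ _ mu0_01) cdf.
Qed.

(** The law given by [coupling_exists] satisfies the bounds, being a coupling. *)
Lemma admissible_exists c D : lsc_square c ->
  (forall u v, bounded_measurable u -> bounded_measurable v ->
    (forall p, unit_square p -> u p.1 - v p.2 <= c p.1 p.2) ->
    mean (mu_phi Om phi) u - mean mu0 v <= D) ->
  exists F dF, admissible F dF /\
    (\int[dF]_(p in `[0%R, 1%R] `*` `[0%R, 1%R]) (c p.1 p.2)%:E <= D%:E)%E.
Proof.
move=> clsc dual.
have [pi [_ pi1 pi2 pic]] := coupling_exists R (mu_phi Om phi) mu0 (mu_phi1 _ _ _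
  phiP) mu0_01 c D clsc dual.
exists (fun g1 g2 => fine (pi (`]-oo, g1] `*` `]-oo, g2]))), pi; split;
  last by rewrite -unit_squareE.
have cdf : is_cdf2 pi (fun g1 g2 => fine (pi (`]-oo, g1] `*` `]-oo, g2]))).
  by move=> g1 g2; rewrite fineK// fin_num_measure//; exact: measurableX.
split => // g1 g2.
rewrite (F_phi_cdf _ _ _ phiP) (F_mu0_cdf _ _ _ mu0_01) cdf.
exact: frechet_of_marginals _ _ _ _ pi1 pi2 g1 g2.
Qed.

(** For the zero cost the dual value is at most 0, so [admissible_exists] yields a
    coupling. *)
Lemma admissible_inhabited : exists F dF, admissible F dF.
Proof.
have [|u v bu bv uv|F [dF [aF _]]] := admissible_exists (fun _ _ => 0) 0;
  last by exists F, dF.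
  by move=> p r _ r0; exists 1.
suff : 0 <= mean mu0 v - mean (mu_phi Om phi) u by lra.
have := mean_gap_ge R mu0 (mu_phi Om phi) mu0_01 (mu_phi1 _ _ _ phiP) 0 v u bv bu.
by rewrite oppr0; apply => p [p1 p2]; have := uv (p.2, p.1) (conj p2 p1) => /=; lra.
Qed.
End kantorovich.

Lemma leb1_01 (R : realType) : leb1 R `[0%R, 1%R]%classic = 1%E.
Proof. by rewrite lebesgue_measure_itv/= lte_fin ltr01 sube0. Qed.

Theorem theorem3 (R : realType) (Om : image_domain R) (lam nu : R)
    (mu0 : probability (mline R) R) (f : R -> R * R -> R)
    (c : R -> R -> R) (a b : R -> R)
    (lam_gt0 : 0 < lam) (nu_gt0 : 0 < nu)
    (mu0_01 : mu0 `[0%R, 1%R]%classic = 1%E)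
    (f_cont : {within `[0, 1] `*` Om, continuous (fun p : R * (R * R) => f p.1 p.2)})
    (c_lsc : lower_semicontinuous
       ((fun p => (c p.1 p.2)%:E) : subspace (`[0, 1] `*` `[0, 1] : set (R * R)) -> \bar R))
    (a_L1 : L1_01 a) (b_L1 : L1_01 b)
    (a_usc : upper_semicontinuous
       ((fun g => (a g)%:E) : subspace (`[0, 1] : set R) -> \bar R))
    (b_usc : upper_semicontinuous
       ((fun g => (b g)%:E) : subspace (`[0, 1] : set R) -> \bar R))
    (c_ge : forall g1 g2, 0 <= g1 <= 1 -> 0 <= g2 <= 1 -> a g1 + b g2 <= c g1 g2) :
  ereal_inf [set
    ereal_sup [set
      (G0 Om lam f phi + nu%:E * (\int[mu_phi Om phi]_(g in `[0%R, 1%R]) (psi.1 g)%:E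
                                  - \int[mu0]_(g in `[0%R, 1%R]) (psi.2 g)%:E))%E
      | psi in [set psi : (R -> R) * (R -> R) |
          [/\ dual_pair c psi.1 psi.2,
              (mu_phi Om phi).-integrable `[0, 1] (EFin \o psi.1) &
              mu0.-integrable `[0, 1] (EFin \o psi.2)]]]
    | phi in Cpp Om]
  =
  ereal_inf [set t | exists (phi : R * R -> R -> R) (F : R -> R -> R)
                            (dF : probability (mplane R) R),
    [/\ Cpp Om phi, is_cdf2 dF F,
        forall g1 g2,
          (F_phi Om phi g1 + F_mu0 mu0 g2 - 1 <= (F g1 g2)%:E
             <= mine (F_phi Om phi g1) (F_mu0 mu0 g2))%E &
        t = (G0 Om lam f phi
             + nu%:E * \int[dF]_(p in `[0%R, 1%R] `*` `[0%R, 1%R]) (c p.1 p.2)%:E)%E]].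
Proof.
have lsc := lsc_squareP R c c_lsc.
have [M cM] := lsc_lower_bound c lsc.
apply/eqP; rewrite eq_le; apply/andP; split.
  apply: le_ereal_inf_tmp => _ [phi [F [dF [phiP cdf bd ->]]]].
  apply: ge_ereal_inf; eexists; first by exists phi; [exact: phiP|reflexivity].
  apply: ge_ereal_sup => _ [[u v] /= [[_ _ uvc] iu iv] <-].
  apply: leeD2l; apply: lee_wpmul2l; first by rewrite lee_fin ltW.
  have bounds := admissible_bounds _ _ _ _ phiP mu0_01 _ _ (conj cdf bd).
  apply: (weak_duality _ _ _ (mu_phi1 _ _ _ phiP) mu0_01 _ bounds c M) => //.
  - by rewrite -unit_squareE; exact: measurable_lsc.
  - by move=> p [p1 p2]; apply: uvc; [move: p1|move: p2]; rewrite /= in_itv.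
apply: le_ereal_inf_tmp => _ [phi phiP <-].
set S := ereal_sup _.
suff [F [dF [[cdf bd] Fle]]] : exists F dF, admissible R Om phi mu0 F dF /\
    (G0 Om lam f phi + nu%:E * \int[dF]_(p in `[0%R, 1%R] `*` `[0%R, 1%R]) (c p.1
      p.2)%:E <= S)%E.
  by apply: ge_ereal_inf; eexists; [exists phi, F, dF; split;
    [exact: phiP|exact: cdf|exact: bd|reflexivity]|].
have mphi1 := mu_phi1 _ _ _ phiP.
have dualS u v : bounded_measurable u -> bounded_measurable v ->
    (forall p, unit_square p -> u p.1 - v p.2 <= c p.1 p.2) ->
    (G0 Om lam f phi + (nu * (mean (mu_phi Om phi) u - mean mu0 v))%:E <= S)%E.
  move=> bu bv uvc; apply: le_ereal_sup_tmp; eexists; last exact: lexx.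
  exists (u, v) => /=.
    split; [split|exact: bounded_measurable_integrable|exact:
      bounded_measurable_integrable].
    - by apply: bounded_measurable_integrable => //; exact: leb1_01.
    - by apply: bounded_measurable_integrable => //; exact: leb1_01.
    - by move=> g1 g2 h1 h2; exact: (uvc (g1, g2)).
  by rewrite !meanE// -EFinB -EFinM.
have [F0 [dF0 a0]] := admissible_inhabited R Om phi mu0 phiP mu0_01.
(* A lower bound of the cost is a dual pair, so the supremum is not minus
   infinity unless G0 is. *)
have uM p : unit_square p -> (fun=> - M) p.1 - (fun=> 0) p.2 <= c p.1 p.2.
  by move=> sp; rewrite subr0; exact: cM.
case GE : (G0 Om lam f phi) => [g| |].
- have := dualS; rewrite GE; case SE : S => [s| |] => dS.
  (* The finite value s of the saddle point problem bounds the dual values by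
     (s - g) / nu. *)
  + have [|F [dF [aF Fle]]] := admissible_exists R Om phi mu0 phiP mu0_01 c ((s - g)
    / nu) lsc.
      move=> u v bu bv uvc; rewrite ler_pdivlMr// mulrC.
      by rewrite lerBrDl -lee_fin EFinD; exact: dS.
    exists F, dF; split => //.
    apply: (@le_trans _ _ (g%:E + nu%:E * ((s - g) / nu)%:E)%E).
      by apply: leeD2l; apply: lee_wpmul2l => //; rewrite lee_fin ltW.
    by rewrite -EFinM -EFinD lee_fin mulrC divfK ?gt_eqF// addrC subrK.
  + by exists F0, dF0; split => //; rewrite leey.
  + by have := dS _ _ (bounded_measurable_cst _) (bounded_measurable_cst _) uM;
    rewrite -EFinD leeNy_eq.
- exists F0, dF0; split => //.
  by have := dualS _ _ (bounded_measurable_cst _) (bounded_measurable_cst _) uM;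
    rewrite GE addye// leye_eq => /eqP ->; rewrite leey.
- by exists F0, dF0; split => //; rewrite addNye leNye.
Qed.
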